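(* Let $\mathcal{T}=(\mathcal{V},\mathcal{E})$ be a tree with $\mathcal{V}=\{1,\dots,d\}$, let $(\boldsymbol{\lambda},\boldsymbol{\alpha})$ be admissible parameters, and let $\boldsymbol{N}=(N_v)_{v\in\mathcal{V}}\sim\mathrm{MPMRF}(\boldsymbol{\lambda},\boldsymbol{\alpha},\mathcal{T})$. Let $X_v=\sum_{j=1}^{N_v}B_{v,j}$ for $v\in\mathcal{V}$ and $S=\sum_{v\in\mathcal{V}}X_v$, where for each $v$ the $\mathbb{N}$-valued variables $B_{v,1},B_{v,2},\dots$ are i.i.d. copies of $B_v$ with $0<\mathbb{E}[B_v]<\infty$, the sequences for different $v$ are mutually independent, and all are independent of $\boldsymbol{N}$. Then for every $v\in\mathcal{V}$ and $\kappa\in[0,1)$, the contribution $\mathcal{C}^{\mathrm{TVaR}}_{\kappa}(X_v;S)$ of $X_v$ to the TVaR of $S$ under Euler's rule is $$\mathcal{C}^{\mathrm{TVaR}}_{\kappa}(X_v;S)=\frac{\lambda_v\mathbb{E}[B_v]}{1-\kappa}\left(1-F_{K^{(v)}+S}(\mathrm{VaR}_\kappa(S))+\frac{F_S(\mathrm{VaR}_\kappa(S))-\kappa}{p_S(\mathrm{VaR}_\kappa(S))}\,p_{K^{(v)}+S}(\mathrm{VaR}_\kappa(S))\right),$$ where $F_Z$ and $p_Z$ denote the cdf and pmf of $Z$, and $K^{(v)}$ is the random variable, independent of $S$, defined in the context.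
   Context: Edges are undirected, so $\alpha_{(u,v)}=\alpha_{(v,u)}$. Parameters $(\boldsymbol{\lambda},\boldsymbol{\alpha})$, with $\boldsymbol{\lambda}=(\lambda_v)_{v\in\mathcal{V}}$ and $\boldsymbol{\alpha}=(\alpha_e)_{e\in\mathcal{E}}$, are admissible if $\lambda_v>0$ for all $v$ and $0<\alpha_{(u,v)}\le\min(\sqrt{\lambda_u/\lambda_v},\sqrt{\lambda_v/\lambda_u})$ for every edge $(u,v)$. Binomial thinning: for an $\mathbb{N}$-valued $Y$ and $\theta\in[0,1]$, $\theta\circ Y:=\sum_{j=1}^{Y}I_j^{(\theta)}$ with $(I_j^{(\theta)})_{j\ge1}$ i.i.d. Bernoulli($\theta$), independent of $Y$. $\boldsymbol{N}\sim\mathrm{MPMRF}(\boldsymbol{\lambda},\boldsymbol{\alpha},\mathcal{T})$ means: for a choice of root $r\in\mathcal{V}$ (the resulting law does not depend on the choice), with $\mathrm{pa}(v)$ the parent of $v$ in $\mathcal{T}$ rooted at $r$, $N_r=L_r$ and $N_v=\big(\alpha_{(\mathrm{pa}(v),v)}\sqrt{\lambda_v/\lambda_{\mathrm{pa}(v)}}\big)\circ N_{\mathrm{pa}(v)}+L_v$ for $v\ne r$, where the $L_v$ are independent, $L_r\sim\mathrm{Poisson}(\lambda_r)$, $L_v\sim\mathrm{Poisson}\big(\lambda_v(1-\alpha_{(\mathrm{pa}(v),v)}\sqrt{\lambda_{\mathrm{pa}(v)}/\lambda_v})\big)$ for $v\neq r$, and the Bernoulli sequences used in the thinnings are mutually independent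 and independent of $(L_v)_{v\in\mathcal{V}}$. A Poisson distribution with parameter $0$ is the point mass at $0$; empty sums are $0$ and empty products are $1$. Risk measures: $\mathrm{VaR}_\kappa(S)=\inf\{x\in\mathbb{R}:F_S(x)\ge\kappa\}$ for $\kappa\in(0,1)$, and $\mathrm{VaR}_0(S)$ is understood as the smallest point of the support of $S$ (which is $0$). The contribution of $X_v$ to the TVaR of $S$ at level $\kappa$ under Euler's rule is $$\mathcal{C}^{\mathrm{TVaR}}_{\kappa}(X_v;S)=\frac{1}{1-\kappa}\Big(\mathbb{E}[X_v\mathbf{1}_{\{S>\mathrm{VaR}_\kappa(S)\}}]+\mathbb{E}[X_v\mid S=\mathrm{VaR}_\kappa(S)]\,\big(F_S(\mathrm{VaR}_\kappa(S))-\kappa\big)\Big).$$ The functions $\eta$: for a rooted tree $\mathcal{T}_r$, with $\mathrm{ch}(v)$ and $\mathrm{dsc}(v)$ the children and (proper) descendants of $v$, define recursively for $\boldsymbol{t}\in[-1,1]^d$, $\theta_j\in[0,1]$, $$\eta_v^{\mathcal{T}_r}\big((t_j)_{j\in\{v\}\cup\mathrm{dsc}(v)};(\theta_j)_{j\in\mathrm{dsc}(v)}\big)=t_v\prod_{j\in\mathrm{ch}(v)}\Big(1-\theta_j+\theta_j\,\eta_j^{\mathcal{T}_r}\big((t_i)_{i\in\{j\}\cup\mathrm{dsc}(j)};(\theta_i)_{i\in\mathrm{dsc}(j)}\big)\Big).$$ The variable $K^{(v)}$: let $\mathcal{T}_v$ be $\mathcal{T}$ rooted at $v$, and let $\boldsymbol{G}^{\mathcal{T}_v}=(G^{\mathcal{T}_v}_w)_{w\in\mathcal{V}}$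 have joint probability generating function $\boldsymbol{t}\mapsto\eta_v^{\mathcal{T}_v}(\boldsymbol{t};\boldsymbol{\theta})$ with $\boldsymbol{\theta}=(\alpha_{(\mathrm{pa}(k),k)}\sqrt{\lambda_k/\lambda_{\mathrm{pa}(k)}})_{k\ne v}$ (parents in $\mathcal{T}_v$). Then $$K^{(v)}=\sum_{i=1}^{G_v^{\mathcal{T}_v}}B^*_{v,i}+\sum_{j\in\mathcal{V}\setminus\{v\}}\sum_{i=1}^{G_j^{\mathcal{T}_v}}B'_{j,i},$$ where $B^*_{v,i}$ are copies of the size-biased transform of $B_v$, with pmf $x\mapsto\frac{x}{\mathbb{E}[B_v]}\Pr(B_v=x)$, $B'_{j,i}$ are copies of $B_j$, all these variables and $\boldsymbol{G}^{\mathcal{T}_v}$ are independent, and $K^{(v)}$ is independent of $S$. *)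

(* Defs.v *)
From mathcomp Require Import all_boot all_order all_algebra.
From mathcomp Require Import finmap.
From mathcomp Require Import all_classical all_reals all_analysis.
Import Order.TTheory GRing.Theory Num.Theory.
Import numFieldNormedType.Exports.

Set Implicit Arguments.
Unset Strict Implicit.
Unset Printing Implicit Defensive.

Local Open Scope classical_set_scope.
Local Open Scope ring_scope.

Section Tree.
Context (V : finType) (e : rel V).

Definition is_tree : Prop :=
  [/\ symmetric e, irreflexive e, (forall u v : V, connect e u v)
    & forall c : seq V, (2 < size c)%N -> ~~ ucycleb e c].

(* u is the last vertex before v on a simple path from r to v. *)
Definition is_parent (r u v : V) : Prop :=
  exists p : seq V,
    [/\ path e r (rcons p v), uniq (r :: rcons p v) & last r p = u].

(* Meaningful for v != r; in a tree the simple path from r to v is unique. *)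
Definition pa (r v : V) : V := odflt v [pick u | `[< is_parent r u v >]].

Definition ch (r v : V) : {set V} := [set j | (j != r) && (pa r j == v)].

Lemma is_parent_pa (r v : V) : is_tree -> v != r -> is_parent r (pa r v) v.
Proof.
move=> [_ _ econ _] vr; rewrite /pa; case: pickP => [u /asboolP//|none].
have /connectP[p0 ep0 vE] := econ r v.
move: vE; case/shortenP: ep0 => p ep up _ vE.
case: (lastP p) ep up vE => [|q x] ep up; rewrite ?last_rcons /= => vE.
  by rewrite vE eqxx in vr.
have /asboolP[] := negbT (none (last r q)); exists q; split=> //.
  by rewrite vE.
by rewrite vE.
Qed.

End Tree.

Section Eta.
Context (R : realType) (V : finType) (e : rel V) (r : V).

(* Only the entries of t at v and its descendants, and of theta at the
   descendants of v, are used. *)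
Fixpoint eta_fuel (n : nat) (t theta : V -> R) (v : V) : R :=
  if n is n'.+1 then
    t v * \prod_(j in ch e r v)
            (1 - theta j + theta j * eta_fuel n' t theta j)
  else t v.

(* A rooted tree has height less than #|V|, so the fuel never runs out: etaE
   below is the defining recursion. *)
Definition eta (v : V) (t theta : V -> R) : R := eta_fuel #|V| t theta v.

Hypothesis tree_e : is_tree e.

Let child : rel V := fun v w => w \in ch e r v.

Let childE v w : child v w = (w != r) && (pa e r w == v).
Proof. by rewrite /child inE. Qed.

Let child_edge v w : child v w -> e v w.
Proof.
rewrite childE => /andP[wr /eqP <-].
have [p [ep _ <-]] := is_parent_pa tree_e wr.
by move: ep; rewrite rcons_path => /andP[].
Qed.

Let child_asym v w : child v w -> ~~ child w v.
Proof.
have [esym eirr _ eacy] := tree_e => cvw; apply/negP => cwv.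
have evw := child_edge cvw.
pose e' : rel V := fun x y => e x y && ~~ ((x \in pred2 v w) && (y \in pred2 v w)).
have e'sym : symmetric e' by move=> x y; rewrite /e' esym [X in ~~ X]andbC.
have half x y : child x y -> y \in pred2 v w -> connect e' r x.
  rewrite childE => /andP[yr /eqP <-] yvw.
  have [p [ep up lp]] := is_parent_pa tree_e yr.
  apply/connectP; exists p => //.
  move: ep up; rewrite rcons_path -rcons_cons rcons_uniq => /andP[ep _] /andP[yp _].
  apply: (sub_in_path (P := predC1 y)) _ ep => [a b ay bY eab|].
    rewrite /e' eab /=; apply/negP => /andP[/pred2P aE /pred2P bE].
    move: ay bY eab; rewrite !inE; move/pred2P: yvw => [] ->;
    by case: aE => ->; case: bE => ->; rewrite ?eqxx ?eirr.
  by apply/allP => z zp; apply: contraNneq yp => <-.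
have cv : connect e' r v by apply: (half v w); rewrite // !inE eqxx orbT.
have cw : connect e' r w by apply: (half w v); rewrite // !inE eqxx.
have : connect e' v w.
  by apply: connect_trans cw; rewrite (sym_connect_sym e'sym).
case/connectP => p0 ep0 wE.
move: wE; case/shortenP: ep0 => p ep up _ wE.
have : (2 < size (v :: p))%N.
  case: p ep wE {up} => [_ /= wv|a [|//] /= /andP[va _] wa].
    by move: evw; rewrite wv eirr.
  by move: va; rewrite /e' -wa !inE !eqxx orbT andbF.
move/eacy; rewrite /ucycleb up andbT /= rcons_path -wE esym evw andbT.
by rewrite (sub_path _ ep) // => a b /andP[].
Qed.

Let desc v := [set w | connect child v w]%SET.

Let desc_child v w : child v w -> (#|desc w| < #|desc v|)%N.
Proof.
have [esym eirr _ eacy] := tree_e => cvw; apply/proper_card/fintype.properP; split.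
  apply/fintype.subsetP => u; rewrite !inE; exact/connect_trans/connect1.
exists v; rewrite !inE ?connect0//; apply/negP => /connectP[p0 cp0 vE].
move: vE; case/shortenP: cp0 => p cp up _ vE.
have : (2 < size (w :: p))%N.
  case: p cp vE {up} => [_ /= wv|a [|//] /= /andP[wa _] va].
    by move: (child_edge cvw); rewrite wv eirr.
  by move: (child_asym cvw); rewrite va wa.
move/eacy; rewrite /ucycleb up andbT /= rcons_path -vE (child_edge cvw) andbT.
by rewrite (sub_path _ cp) // => a b /child_edge.
Qed.

Let eta_stable t theta n m v : (#|desc v| <= n)%N -> (#|desc v| <= m)%N ->
  eta_fuel n t theta v = eta_fuel m t theta v.
Proof.
have desc_gt0 u : (0 < #|desc u|)%N.
  by apply/card_gt0P; exists u; rewrite inE connect0.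
elim: n m v => [|n IHn] [|m] v; rewrite ?leqn0 ?eqn0Ngt ?desc_gt0 // => ln lm.
rewrite /=; congr (_ * _); apply: eq_bigr => j /desc_child jv.
by rewrite (IHn m) // -ltnS; exact: leq_trans jv _.
Qed.

Lemma etaE (v : V) (t theta : V -> R) :
  eta v t theta =
  t v * \prod_(j in ch e r v) (1 - theta j + theta j * eta j t theta).
Proof.
rewrite -[RHS]/(eta_fuel #|V|.+1 t theta v).
by apply: eta_stable; rewrite ?leqW // max_card.
Qed.

End Eta.

Section Admissible.
Context (R : realType) (V : finType) (e : rel V).
Implicit Types (lambda : V -> R) (alpha : V -> V -> R).

(* alpha u v is the parameter of the undirected edge (u, v); its value on
   non-edges is never used. *)
Definition admissible lambda alpha : Prop :=
  [/\ forall v, 0 < lambda v,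
      forall u v, e u v -> alpha u v = alpha v u
    & forall u v, e u v ->
        0 < alpha u v <= Num.min (Num.sqrt (lambda u / lambda v))
                                 (Num.sqrt (lambda v / lambda u))].

Definition thinning_prob lambda alpha (r k : V) : R :=
  alpha (pa e r k) k * Num.sqrt (lambda k / lambda (pa e r k)).

Definition innovation_rate lambda alpha (r v : V) : R :=
  if v == r then lambda r
  else lambda v * (1 - alpha (pa e r v) v * Num.sqrt (lambda (pa e r v) / lambda v)).

End Admissible.

Section Independence.
Context d (T : measurableType d) (R : realType) (P : probability T R).

(* Product rule over every finite subfamily of the families of events F i,
   i in D. *)
Definition mutual_independence (I : choiceType) (D : set I)
    (F : I -> set (set T)) : Prop :=
  forall J : {fset I}, [set` J] `<=` D ->
  forall E : I -> set T, (forall i, i \in J -> F i (E i)) ->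
    P (\bigcap_(i in [set` J]) E i) = (\prod_(i <- J) P (E i))%E.

(* The sigma-algebra generated by a random variable; that generated jointly by
   finitely many of them is the library's g_sigma_preimage. *)
Definition sigma_rv d' (T' : measurableType d') (X : T -> T') : set (set T) :=
  preimage_set_system setT X measurable.

Definition independent_rv d' (T' : measurableType d') (X Y : T -> T') : Prop :=
  mutual_independence setT (fun b : bool => sigma_rv (if b then X else Y)).

End Independence.

Section Model.
Context (n : nat) (R : realType) (e : rel 'I_n).
Context (lambda : 'I_n -> R) (alpha : 'I_n -> 'I_n -> R).

Section Construction.
Context d (T : measurableType d) (P : probability T R).

Definition thinning (I : nat -> {RV P >-> bool}) (Y : T -> nat) (w : T) : nat :=
  (\sum_(j < Y w) I j w)%N.

(* There is no thinning at the root, so the sequence Bern r is left out.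
   poisson_prob ignores its second argument, and is the point mass at 0 when its
   rate is 0. *)
Definition MPMRF_construction (r : 'I_n) (L : 'I_n -> {RV P >-> nat})
    (Bern : 'I_n -> nat -> {RV P >-> bool}) (N : 'I_n -> T -> nat) : Prop :=
  [/\ forall v, distribution P (L v) =1
        poisson_prob (innovation_rate e lambda alpha r v) 0%N,
      forall v j, v != r -> distribution P (Bern v j) =1
        bernoulli_prob (thinning_prob e lambda alpha r v),
      mutual_independence P
        [set k : 'I_n + 'I_n * nat | if k is inr (v, _) then v != r else true]
        (fun k => match k with
                  | inl v => sigma_rv (L v)
                  | inr (v, j) => sigma_rv (Bern v j)
                  end),
      forall w, N r w = L r w
    & forall v, v != r ->
        forall w, N v w = (thinning (Bern v) (N (pa e r v)) w + L v w)%N].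

End Construction.

(* N has the law of the vector obtained from the construction, possibly carried
   out on another probability space. Every set of vectors of naturals is
   measurable, so A ranges over all of them. *)
Definition MPMRF d (T : measurableType d) (P : probability T R)
    (N : 'I_n -> {RV P >-> nat}) : Prop :=
  exists (r : 'I_n) (d' : measure_display) (T' : measurableType d')
      (P' : probability T' R) (L : 'I_n -> {RV P' >-> nat})
      (Bern : 'I_n -> nat -> {RV P' >-> bool}) (N' : 'I_n -> {RV P' >-> nat}),
    MPMRF_construction r L Bern (fun v => N' v : T' -> nat) /\
    forall A : set ('I_n -> nat),
      P [set w | A (fun v => N v w)] = P' [set w | A (fun v => N' v w)].

End Model.

Section CompoundSum.
Context (n : nat) (R : realType) d (T : measurableType d) (P : probability T R).

Definition mean (B : {RV P >-> nat}) : \bar R := 'E_P[fun w => (B w)%:R].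

Definition copy (B' B : {RV P >-> nat}) : Prop :=
  distribution P B' =1 distribution P B.

Definition size_biased (B' B : {RV P >-> nat}) : Prop :=
  forall x : nat, P (B' @^-1` [set x]) =
    ((x%:R / fine (mean B))%:E * P (B @^-1` [set x]))%E.

(* The terms B_1, ..., B_N of the sum are B 0, ..., B (N - 1). *)
Definition compound (N : {RV P >-> nat}) (B : nat -> {RV P >-> nat}) (w : T) : R :=
  \sum_(j < N w) (B j w)%:R.

(* The sequences Bs v have independent terms, are independent of each other and
   jointly independent of N: together, the vector N and all the Bs v j are
   mutually independent. *)
Definition claims_independent (N : 'I_n -> {RV P >-> nat})
    (Bs : 'I_n -> nat -> {RV P >-> nat}) : Prop :=
  mutual_independence P setT
    (fun k : unit + 'I_n * nat =>
       match k with
       | inl _ => g_sigma_preimage (fun v => N v : T -> nat)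
       | inr (v, j) => sigma_rv (Bs v j)
       end).

Definition has_joint_pgf (G : 'I_n -> {RV P >-> nat}) (g : ('I_n -> R) -> R) : Prop :=
  forall t : 'I_n -> R, (forall u, -1 <= t u <= 1) ->
    ('E_P[fun w => (\prod_u t u ^+ G u w)%R] = (g t)%:E)%E.

(* K is the variable K^(v); the sequence Bprime v is not used, hence left out. *)
Definition K_construction (e : rel 'I_n) (lambda : 'I_n -> R)
    (alpha : 'I_n -> 'I_n -> R) (B : 'I_n -> {RV P >-> nat}) (v : 'I_n)
    (G : 'I_n -> {RV P >-> nat}) (Bstar : nat -> {RV P >-> nat})
    (Bprime : 'I_n -> nat -> {RV P >-> nat}) (K : {RV P >-> R}) : Prop :=
  [/\ has_joint_pgf G
        (fun t => eta e v v t (thinning_prob e lambda alpha v)),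
      forall i, size_biased (Bstar i) (B v),
      forall j i, j != v -> copy (Bprime j i) (B j),
      mutual_independence P
        [set k : unit + nat + 'I_n * nat | if k is inr (j, _) then j != v else true]
        (fun k => match k with
                  | inl (inl _) => g_sigma_preimage (fun u => G u : T -> nat)
                  | inl (inr i) => sigma_rv (Bstar i)
                  | inr (j, i) => sigma_rv (Bprime j i)
                  end)
    & forall w, K w = compound (G v) Bstar w
                      + \sum_(j | j != v) compound (G j) (Bprime j) w].

End CompoundSum.

Section RiskMeasures.
Context d (T : measurableType d) (R : realType) (P : probability T R).

(* At level 0, the smallest point of the support; S is meant to be discrete. *)
Definition VaR (S : {RV P >-> R}) (kappa : R) : R :=
  if 0 < kappa then inf [set x | (kappa%:E <= cdf S x)%E]
  else inf [set x | 0 < pmf S x].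

(* E[X | S = s], for an atom s of S *)
Definition cond_expectation (X S : {RV P >-> R}) (s : R) : \bar R :=
  ('E_P[X \* \1_(S @^-1` [set s])] * ((pmf S s)^-1)%:E)%E.

Definition TVaR_contribution (X S : {RV P >-> R}) (kappa : R) : \bar R :=
  let q := VaR S kappa in
  (((1 - kappa)^-1)%:E *
   ('E_P[X \* \1_[set w | (q < S w)%R]]
    + cond_expectation X S q * (cdf S q - kappa%:E)))%E.

End RiskMeasures.

(* Main.v *)
Require Import Defs.
From mathcomp Require Import finmap.
From mathcomp Require Import all_boot all_order all_algebra.
From mathcomp Require Import all_classical all_reals all_analysis measurable_realfun.
From mathcomp Require Import ring lra.
Import Order.TTheory GRing.Theory Num.Theory.
Import numFieldNormedType.Exports.

Set Implicit Arguments.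
Unset Strict Implicit.
Unset Printing Implicit Defensive.

Local Open Scope classical_set_scope.
Local Open Scope ring_scope.

(** The formula reduces to the identity E[X_v; S = m] = lambda_v E[B_v] P(K + S = m)
    for every natural m, which is obtained by comparing generating functions in
    one variable t in ]0, 1].  Write phi_u = E[t^B_u].  Peeling off the leaves of
    the tree gives E[prod_u phi_u^N_u] = exp(sum_w rate_w (eta_w(phi) - 1)) for the
    root r used in the construction of N.  This expression is unchanged when the
    root moves along an edge, so that v may be taken as the root; it is then the
    exponential of an affine function of phi_v of slope lambda_v eta_v(phi) / phi_v.
    Comparing power series in phi_v yields
    E[N_v phi_v^(N_v - 1) prod_(u != v) phi_u^N_u]
    = lambda_v (eta_v(phi) / phi_v) E[prod_u phi_u^N_u],
    where eta_v(phi) / phi_v stands for the value of eta_v at phi with phi_v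
    replaced by 1.  The left-hand side times E[B_v t^B_v] is E[X_v t^S], while
    E[B_v t^B_v] = E[B_v] E[t^B*_v] and E[t^K] = E[t^B*_v] eta_v(phi) / phi_v. *)

(** * Rooted trees and the functions eta *)

(** Every integrand is nonnegative, so sums and integrals may be exchanged freely and most
    identities are stated in extended reals. Taking t in ]0, 1] keeps phi and [eta] in [0, 1] and
    lets t be cancelled when coefficients are compared. Comparing power series in phi_v avoids
    differentiating under the expectation: the masses of N_v weighted by the other variables are a
    constant times b^k / k!, the weights of a Poisson law, for which k p_k = b p_(k-1). The root is
    existential in [MPMRF], whereas K^(v) uses the tree rooted at v; this is why the logarithm of
    the generating function has to be studied as a function of the root. The main obstacle is that
    thinnings and compound sums have a random number of terms, while independence is a product rule
    for fixed finite families. Each such computation is therefore made on a fiber of the counting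
    variables, where the number of factors is fixed, and the fibers are then summed. *)

Section TreeTheory.
Context (V : finType) (e : rel V).
Hypothesis tree_e : is_tree e.

(** Two candidates [a] and [b] are both joined to [r], hence to each other, by paths that avoid [u].
    If they differ, a simple such path closed through [u] is a cycle of length at least 3. *)
Lemma is_parent_inj r a b u : is_parent e r a u -> is_parent e r b u -> a = b.
Proof.
have [esym _ _ eacy] := tree_e.
pose e' : rel V := fun x y => [&& e x y, x != u & y != u].
have e'sym : symmetric e'.
  by move=> x y; rewrite /e' esym [(x != u) && _]andbC.
have parent_connect c : is_parent e r c u -> [/\ connect e' r c, e c u & c != u].
  case=> p [ep up <-].
  move: ep up; rewrite rcons_path -rcons_cons rcons_uniq => /andP[ep ec] /andP[nu _].
  split => //; last by apply: contraNneq nu => <-; exact: mem_last.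
  apply/connectP; exists p => //.
  apply: (sub_in_path (P := predC1 u)) _ ep => [x y xu yu exy|].
    by apply/and3P; split.
  by apply/allP => z zp; apply: contraNneq nu => <-.
move=> /parent_connect[ca ea au] /parent_connect[cb eb bu].
apply/eqP/negP => /negP ab.
have : connect e' a b by apply: connect_trans cb; rewrite (sym_connect_sym e'sym).
case/connectP => p0 ep0 bE; move: bE; case/shortenP: ep0 => p ep up _ bE.
have : (2 < size (u :: a :: p))%N.
  by case: p ep bE {up} => //= _ ba; rewrite ba eqxx in ab.
move/eacy/negP; apply; apply/andP; split; last first.
  rewrite cons_uniq up andbT in_cons negb_or eq_sym au /=.
  apply/negP => upp; case/splitPr: upp ep => p1 p2.
  by rewrite cat_path /= {2}/e' eqxx !andbF.
rewrite /= rcons_path -bE eb andbT esym ea /=.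
by apply: sub_path ep => x y /and3P[].
Qed.

Lemma pa_eq r a u : u != r -> is_parent e r a u -> pa e r u = a.
Proof. by move=> ur; apply: is_parent_inj; exact: is_parent_pa. Qed.

Lemma pa_edge r u : u != r -> e (pa e r u) u.
Proof.
move=> ur; have [p [ep _ <-]] := is_parent_pa tree_e ur.
by move: ep; rewrite rcons_path => /andP[].
Qed.

(** The rank is the distance from [r]: a shortest path can be made simple, its last vertex but one
    is then the parent, and dropping the end leaves a shorter path to that parent. *)
Lemma pa_rank r : exists rank : V -> nat,
  forall u, u != r -> (rank (pa e r u) < rank u)%N.
Proof.
have [_ _ econ _] := tree_e.
have ex u : exists m, [exists p : m.-tuple V, path e r p && (last r p == u)].
  have /connectP[p ep ->] := econ r u; exists (size p).
  by apply/existsP; exists (in_tuple p); rewrite /= ep eqxx.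
exists (fun u => ex_minn (ex u)) => u ur.
case: (ex_minnP (ex u)) => m /existsP[p0 /andP[ep0 /eqP lu]] _.
rewrite -(size_tuple p0); move: lu; case/shortenP: ep0 => p ep up sp lu.
have := uniq_leq_size (subseq_uniq (subseq_cons p r) up) sp; apply: leq_trans.
case/lastP: p ep up lu {sp} => [_ _ /= ru|q x]; first by rewrite ru eqxx in ur.
rewrite last_rcons size_rcons => ep up xu; rewrite {x}xu in ep up *.
rewrite (pa_eq ur (a := last r q)); last by exists q.
case: ex_minnP => k _; rewrite ltnS; apply; apply/existsP; exists (in_tuple q) => /=.
by move: ep; rewrite rcons_path => /andP[-> _] /=.
Qed.

Lemma edge_neq r s : e r s -> r != s.
Proof. by have [_ eirr _ _] := tree_e; apply: contraTneq => ->; rewrite eirr. Qed.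

Lemma pa_adjacent r s : e r s -> pa e r s = r.
Proof.
move=> ers; have rs := edge_neq ers.
by apply: pa_eq; rewrite 1?eq_sym//; exists [::]; split; rewrite //= ?ers ?andbT ?inE.
Qed.

(** If the simple path from [r] to [u] avoids [s], put [s] in front of it. Otherwise [s] is its
    first step, since a later visit would make a cycle with the edge between [r] and [s]; then
    remove [r]. *)
Lemma is_parent_swap r s a u : e r s -> u != s ->
  is_parent e r a u -> is_parent e s a u.
Proof.
have [esym _ _ eacy] := tree_e => ers us [p [ep up <-]].
have [sp|sp] := boolP (s \in rcons p u); last first.
  exists (r :: p); split => //; first by rewrite /= esym ers.
  by rewrite /= in up *; rewrite in_cons negb_or sp eq_sym edge_neq.
have {}sp : s \in p by move: sp; rewrite mem_rcons in_cons eq_sym (negbTE us).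
case: p sp ep up => // x p; rewrite in_cons => /predU1P[<-|sp] ep up.
  by exists p; split => //; [case/andP: ep|case/andP: up].
case/splitPr: sp ep up => p1 p2.
rewrite -cat_cons rcons_cat cat_path => /andP[ep /= /andP[es _]].
rewrite -[X in X -> _]/(is_true (uniq ((r :: x :: p1) ++ s :: rcons p2 u)))
  -cat_rcons cat_uniq => /andP[up _].
have := eacy (r :: rcons (x :: p1) s); rewrite /= size_rcons => /(_ isT) /negP[].
rewrite /ucycleb up andbT /=.
by move: ep => /= /andP[-> ep]; rewrite !rcons_path ep /= es last_rcons esym ers.
Qed.

Lemma pa_swap r s u : e r s -> u != r -> u != s -> pa e s u = pa e r u.
Proof.
move=> ers ur us; apply: pa_eq => //.
by apply: is_parent_swap ers us _; exact: is_parent_pa.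
Qed.

End TreeTheory.

Section Children.
Context (V : finType) (e : rel V).
Hypothesis tree_e : is_tree e.

Lemma mem_ch r w j : (j \in ch e r w) = (j != r) && (pa e r j == w).
Proof. by rewrite inE. Qed.

(** Induction from the leaves to the root: the gap between the maximal rank and the rank of a vertex
    decreases from parent to child. *)
Lemma ch_ind r (Q : V -> Prop) :
  (forall w, (forall j, j \in ch e r w -> Q j) -> Q w) -> forall w, Q w.
Proof.
move=> QI w; have [rank rankP] := pa_rank tree_e r.
have rank_max u : (rank u <= \max_i rank i)%N by exact: leq_bigmax.
have [m] := ubnP (\max_i rank i - rank w); elim: m w => // m IHm w wm.
apply: QI => j; rewrite mem_ch => /andP[jr /eqP pj]; apply: IHm.
have := rankP _ jr; rewrite pj => wj.
by rewrite -ltnS (leq_trans _ wm)// ltnS ltn_sub2l// (leq_trans wj).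
Qed.

(** Moving the root along an edge reverses this edge and no other, so only [r] and [s] get other
    children. *)
Lemma ch_swap r s w : e r s -> w != r -> w != s -> ch e s w = ch e r w.
Proof.
move=> ers wr ws; have esr : e s r by have [-> _ _ _] := tree_e.
apply/setP => j; rewrite !mem_ch.
have [->|jr] /= := eqVneq j r.
  by rewrite (pa_adjacent tree_e esr) (eq_sym s) (negbTE ws) andbF.
have [->|js] /= := eqVneq j s.
  by rewrite (pa_adjacent tree_e ers) eq_sym (negbTE wr).
by rewrite (pa_swap tree_e ers).
Qed.

Lemma ch_swap_root r s : e r s -> ch e s s = r |: ch e r s.
Proof.
move=> ers; have esr : e s r by have [-> _ _ _] := tree_e.
apply/setP => j; rewrite in_setU1 !mem_ch.
have [->|jr] /= := eqVneq j r.
  by rewrite (pa_adjacent tree_e esr) eqxx andbT; exact: edge_neq ers.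
have [->|js] /= := eqVneq j s.
  by rewrite (pa_adjacent tree_e ers) (negbTE (edge_neq tree_e ers)).
by rewrite (pa_swap tree_e ers).
Qed.

Lemma root_notin_ch r w : r \notin ch e r w.
Proof. by rewrite mem_ch eqxx. Qed.

End Children.

(** * Change of root *)

Section EtaTheory.
Context (R : realType) (V : finType) (e : rel V).
Hypothesis tree_e : is_tree e.
Context (lambda : V -> R) (alpha : V -> V -> R).
Hypothesis adm : admissible e lambda alpha.
Implicit Types (r s u v w : V) (t : V -> R).

Local Notation theta := (thinning_prob e lambda alpha).
Local Notation rate := (innovation_rate e lambda alpha).

Let lambda_gt0 v : 0 < lambda v. Proof. by case: adm. Qed.

Lemma mul_sqrt_div (a b : R) : 0 < a -> 0 < b ->
  a * Num.sqrt (b / a) = Num.sqrt (a * b).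
Proof.
move=> a0 b0; rewrite -{1}(sqr_sqrtr (ltW a0)) sqrtrM ?(ltW b0)// sqrtrV ?ltW//.
rewrite sqrtrM ?(ltW a0)//; have : Num.sqrt a != 0 by rewrite sqrtr_eq0 -ltNge.
by move=> ?; field.
Qed.

Lemma sqrt_div_mul (a b : R) : 0 < a -> 0 < b ->
  Num.sqrt (a / b) * Num.sqrt (b / a) = 1.
Proof.
move=> a0 b0; rewrite -sqrtrM ?divr_ge0 ?ltW//.
by rewrite mulrA divfK ?gt_eqF// divff ?gt_eqF// sqrtr1.
Qed.

(** One entry of the minimum in [admissible] bounds the thinning probability by 1; the other makes
    the innovation rate nonnegative below. *)
Lemma thinning_prob_itv r u : u != r -> 0 <= theta r u <= 1.
Proof.
move=> ur; have epu := pa_edge tree_e ur.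
have [_ _ /(_ _ _ epu)/andP[a0]] := adm; rewrite le_min => /andP[a1 _].
rewrite mulr_ge0 ?sqrtr_ge0 ?(ltW a0)//= -(sqrt_div_mul (lambda_gt0 (pa e r u))
  (lambda_gt0 u)).
by rewrite /thinning_prob ler_wpM2r ?sqrtr_ge0.
Qed.

Lemma innovation_rate_ge0 r u : 0 <= rate r u.
Proof.
rewrite /innovation_rate; case: ifPn => [_|ur]; first exact: ltW.
have epu := pa_edge tree_e ur.
have [_ _ /(_ _ _ epu)/andP[a0]] := adm; rewrite le_min => /andP[_ a1].
rewrite mulr_ge0 ?(ltW (lambda_gt0 _))// subr_ge0.
rewrite -(sqrt_div_mul (lambda_gt0 u) (lambda_gt0 (pa e r u))).
by rewrite ler_wpM2r ?sqrtr_ge0.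
Qed.

(** The innovation supplies what the thinned parent lacks to reach the mean [lambda u]; the
    subtracted term is alpha times the square root of the product of the two lambdas in both
    forms. *)
Lemma innovation_rate_nonroot r u : u != r ->
  rate r u = lambda u - lambda (pa e r u) * theta r u.
Proof.
move=> ur; rewrite /innovation_rate (negbTE ur) /thinning_prob.
rewrite mulrBr mulr1 mulrCA mul_sqrt_div// [in RHS]mulrCA mul_sqrt_div//.
by rewrite (mulrC (lambda u)).
Qed.

Lemma thinning_prob_swap r s u : e r s -> u != r -> u != s ->
  theta s u = theta r u.
Proof. by move=> ers ur us; rewrite /thinning_prob (pa_swap tree_e ers). Qed.

Lemma innovation_rate_swap r s u : e r s -> u != r -> u != s ->
  rate s u = rate r u.
Proof.
move=> ers ur us.
by rewrite /innovation_rate (negbTE ur) (negbTE us) (pa_swap tree_e ers).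
Qed.

(** Both sides equal [alpha r s * Num.sqrt (lambda r * lambda s)]. This symmetry is the source of
    the independence of the root. *)
Lemma thinning_prob_edge r s : e r s ->
  lambda r * theta r s = lambda s * theta s r.
Proof.
move=> ers; have esr : e s r by have [-> _ _ _] := tree_e.
have [_ asym _] := adm.
rewrite /thinning_prob !(pa_adjacent tree_e)// mulrCA mul_sqrt_div//.
by rewrite [in RHS]mulrCA mul_sqrt_div// asym// (mulrC (lambda r)).
Qed.

Lemma eta_swap r s w t : e r s -> w != r -> w != s ->
  eta e s w t (theta s) = eta e r w t (theta r).
Proof.
move=> ers; elim/(ch_ind tree_e (r := r)): w => w IH wr ws.
rewrite [LHS]etaE// [RHS]etaE// (ch_swap tree_e ers)//; congr *%R;
  apply: eq_bigr => j jw.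
have /andP[jr /eqP pj] : (j != r) && (pa e r j == w) by rewrite -mem_ch.
have js : j != s.
  by apply: contraNneq wr => js; rewrite -pj js (pa_adjacent tree_e ers).
by rewrite IH// (thinning_prob_swap ers).
Qed.

(** As a root, [s] keeps its former children and gains [r], which contributes the last factor. *)
Lemma eta_swap_root r s t : e r s ->
  eta e s s t (theta s) =
  eta e r s t (theta r) * (1 - theta s r + theta s r * eta e s r t (theta s)).
Proof.
move=> ers; have esr : e s r by have [-> _ _ _] := tree_e.
rewrite [LHS]etaE// (ch_swap_root tree_e ers) big_setU1 ?root_notin_ch//=.
rewrite [eta e r s _ _]etaE// mulrA [RHS]mulrAC; congr *%R.
apply: eq_bigr => j; rewrite mem_ch => /andP[jr /eqP pj].
have js : j != s.
  by apply/eqP => js; move: pj (edge_neq tree_e ers);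
    rewrite js (pa_adjacent tree_e ers) => ->; rewrite eqxx.
by rewrite (eta_swap _ ers)// (thinning_prob_swap ers).
Qed.

(* The logarithm of the probability generating function of the MPMRF, computed
   with the tree rooted at r. *)
Definition log_pgf r t : R :=
  \sum_w rate r w * (eta e r w t (theta r) - 1).

(** Only the terms at [r] and [s] change. Let a and b be the values of [eta] on the branches at [s]
    and [r] that remain when the edge is cut; the two terms add up to lambda_r (b - 1) + lambda_s (a
    - 1) + lambda_r theta_rs (a - 1) (b - 1), which is symmetric by [thinning_prob_edge]. *)
Lemma log_pgf_adjacent r s t : e r s -> log_pgf s t = log_pgf r t.
Proof.
move=> ers; have esr : e s r by have [-> _ _ _] := tree_e.
have rs := edge_neq tree_e ers; have sr := edge_neq tree_e esr.
have split2 (f : V -> R) :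
    \sum_w f w = f r + f s + \sum_(w | (w != r) && (w != s)) f w.
  by rewrite (bigD1 r)//= (bigD1 s)//= addrA.
rewrite /log_pgf ![in LHS]split2 ![in RHS]split2.
congr +%R; last first.
  apply: eq_bigr => w /andP[wr ws].
  by rewrite (innovation_rate_swap ers)// (eta_swap _ ers).
rewrite (eta_swap_root _ ers) (eta_swap_root _ esr).
rewrite (innovation_rate_nonroot sr) (innovation_rate_nonroot rs) !(pa_adjacent
  tree_e)//.
rewrite /innovation_rate !eqxx.
have := thinning_prob_edge ers.
move: (eta e s r _ _) (eta e r s _ _) (lambda r) (lambda s) (theta r s) (theta s r).
by move=> a b lr ls tr ts H; ring: H.
Qed.

Lemma log_pgf_root r s t : log_pgf s t = log_pgf r t.
Proof.
have [_ _ econ _] := tree_e; have /connectP[p ep ->] := econ r s.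
elim: p r ep => //= x p IH r /andP[erx /IH ->]; exact: log_pgf_adjacent.
Qed.

Lemma eta_itv r w t : (forall u, 0 <= t u <= 1) ->
  0 <= eta e r w t (theta r) <= 1.
Proof.
move=> t01; elim/(ch_ind tree_e (r := r)): w => w IH; rewrite etaE//.
have /andP[tw0 tw1] := t01 w.
have fac j : j \in ch e r w ->
    0 <= 1 - theta r j + theta r j * eta e r j t (theta r) <= 1.
  move=> jw; have /andP[jr _] : (j != r) && (pa e r j == w) by rewrite -mem_ch.
  have /andP[e0 e1] := IH j jw; have /andP[h0 h1] := thinning_prob_itv jr.
  rewrite addr_ge0 ?subr_ge0 ?(mulr_ge0 h0)//=.
  by have := ler_piMr h0 e1; lra.
have prod_ge0 : 0 <= \prod_(j in ch e r w)
    (1 - theta r j + theta r j * eta e r j t (theta r)).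
  by apply: prodr_ge0 => i ij; case/andP: (fac _ ij).
rewrite mulr_ge0//= mulr_ile1//; apply: prodr_ile1 => j jw; exact: fac.
Qed.

Lemma eta_nonroot r w t t' : (forall u, u != r -> t u = t' u) -> w != r ->
  eta e r w t (theta r) = eta e r w t' (theta r).
Proof.
move=> tt'; elim/(ch_ind tree_e (r := r)): w => w IH wr.
rewrite [LHS]etaE// [RHS]etaE// tt'//; congr *%R; apply: eq_bigr => j jw.
by rewrite IH//; move: jw; rewrite mem_ch => /andP[].
Qed.

Lemma eta_root_linear r t x :
  eta e r r [eta t with r |-> x] (theta r) =
  x * eta e r r [eta t with r |-> 1] (theta r).
Proof.
rewrite [LHS]etaE// [in RHS]etaE//= !eqxx mul1r; congr *%R; apply: eq_bigr => j.
rewrite mem_ch => /andP[jr _]; congr (_ + _ * _); apply: eta_nonroot => // u ur /=.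
by rewrite (negbTE ur).
Qed.

(** The root belongs to no proper subtree, so its variable occurs only in the root's own term, as a
    linear factor of [eta]. *)
Lemma log_pgf_affine r t x :
  log_pgf r [eta t with r |-> x] =
  log_pgf r [eta t with r |-> 0]
  + lambda r * eta e r r [eta t with r |-> 1] (theta r) * x.
Proof.
rewrite /log_pgf [in LHS](bigD1 r)//= [in RHS](bigD1 r)//= eta_root_linear [in
  RHS]eta_root_linear.
have -> : \sum_(w | w != r) rate r w * (eta e r w [eta t with r |-> x] (theta r) - 1)
        = \sum_(w | w != r) rate r w * (eta e r w [eta t with r |-> 0] (theta r) - 1).
  apply: eq_bigr => w wr; congr (_ * (_ - 1)).
  by apply: eta_nonroot => // u ur /=; rewrite (negbTE ur).
by rewrite {1 3}/innovation_rate eqxx; ring.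
Qed.

End EtaTheory.

(** * Discrete random variables and generating functions *)

Section Fibers.
Context {d} {T : measurableType d} {R : realType} {P : probability T R}.

(** For values in a countable type this makes every function of [Z] measurable, whatever
    sigma-algebra the target carries; in particular vectors of naturals need no sigma-algebra of
    their own. *)
Definition measurable_fibers (C : Type) (Z : T -> C) : Prop :=
  forall c, measurable (Z @^-1` [set c]).

Lemma measurable_fibers_rv d' (C : measurableType d') (Z : {RV P >-> C}) :
  (forall c : C, measurable [set c]) -> measurable_fibers Z.
Proof. by move=> mC c; rewrite -[X in measurable X]setTI; exact: measurable_funP. Qed.

Lemma measurable_fibers_pickle (C : countType) (Z : T -> C) :
  measurable_fibers Z -> measurable_fibers (pickle \o Z).
Proof.
move=> mZ k; case E : (@pickle_inv C k) => [c|].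
  have -> : (pickle \o Z) @^-1` [set k] = Z @^-1` [set c]; last exact: mZ.
  apply/seteqP; split=> w /= Zw.
    by move: E; rewrite -Zw pickleK_inv => -[].
  by rewrite Zw; have := @pickle_invK C k; rewrite E.
have -> : (pickle \o Z) @^-1` [set k] = set0; last exact: measurable0.
by apply/seteqP; split=> w //= Zw; move: E; rewrite -Zw pickleK_inv.
Qed.

Lemma measurable_fibers_comp (C : countType) (C' : Type) (Z : T -> C) (h : C -> C') :
  measurable_fibers Z -> forall A : set C', measurable ((h \o Z) @^-1` A).
Proof.
move=> mZ A; have mpZ := measurable_fibers_pickle mZ.
have -> : (h \o Z) @^-1` A =
    \bigcup_(k in [set k | exists c, pickle c = k /\ A (h c)]) ((pickle \o Z) @^-1`
      [set k]).
  apply/seteqP; split=> w /= => [Aw|[_ [c [<- Ac]] /= /(pcan_inj pickleK) ->]//].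
  by exists (pickle (Z w)) => //; exists (Z w).
by apply: bigcup_measurable => k _; exact: mpZ.
Qed.

Lemma measurable_fun_fibers (C : countType) d' (C' : measurableType d')
    (Z : T -> C) (h : C -> C') :
  measurable_fibers Z -> measurable_fun setT (h \o Z).
Proof. by move=> mZ _ A _; rewrite setTI; exact: measurable_fibers_comp. Qed.

Lemma measurable_fibers_vector (I : finType) (C : countType) (Z : I -> T -> C) :
  (forall i, measurable_fibers (Z i)) ->
  measurable_fibers (fun w => [ffun i => Z i w]).
Proof.
move=> mZ c; have -> : (fun w => [ffun i => Z i w]) @^-1` [set c] =
    \bigcap_(i in [set` enum I]) Z i @^-1` [set c i].
  apply/seteqP; split=> w /= => [<- i _ /=|H]; first by rewrite ffunE.
  by apply/ffunP => i; rewrite ffunE; apply: H; rewrite /= mem_enum.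
by rewrite bigcap_seq; apply: bigsetI_measurable => i _; exact: mZ.
Qed.

Lemma measurable_bigprod (I : Type) (s : seq I) (Q : pred I) (f : I -> T -> R) :
  (forall i, measurable_fun setT (f i)) ->
  measurable_fun setT (fun x => \prod_(i <- s | Q i) f i x).
Proof.
move=> mf; elim: s => [|i s IHs].
  by under eq_fun do rewrite big_nil; exact: measurable_cst.
under eq_fun do rewrite big_cons; case: (Q i) => //.
by apply: measurable_funM => //; exact: mf.
Qed.

Lemma measurable_fibersD (Z W : T -> nat) :
  measurable_fibers Z -> measurable_fibers W ->
  measurable_fibers (fun x => (Z x + W x)%N).
Proof.
move=> mZ mW k.
have mZW : measurable_fibers (fun x => (Z x, W x)).
  move=> [i j]; rewrite [X in measurable X](_ : _ = Z @^-1` [set i] `&` W @^-1`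
    [set j]).
    exact: measurableI.
  by apply/seteqP; split=> x /= => [[-> ->]|[-> ->]].
exact: (measurable_fibers_comp (fun p => p.1 + p.2)%N mZW).
Qed.

Lemma measurable_fibers_sum (I : Type) (s : seq I) (Z : I -> T -> nat) :
  (forall i, measurable_fibers (Z i)) ->
  measurable_fibers (fun x => \sum_(i <- s) Z i x)%N.
Proof.
move=> mZ; elim: s => [|i s IHs].
  have -> : (fun x => \sum_(i <- [::]) Z i x)%N = cst 0%N.
    by apply/funext => x; rewrite big_nil.
  by move=> k; rewrite preimage_cst; case: ifP.
rewrite (_ : (fun x => _) = (fun x => (Z i x + \sum_(j <- s) Z j x)%N)).
  exact: measurable_fibersD.
by apply/funext => x; rewrite big_cons.
Qed.

Local Open Scope ereal_scope.

(** This plays the part of conditioning: it freezes a random number of terms at each of its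
    values. *)
Lemma ge0_integral_fibers (Z : T -> nat) (D : set T) (f : T -> \bar R) :
  measurable_fibers Z -> measurable D -> measurable_fun setT f ->
  (forall x, 0 <= f x) ->
  \int[P]_(x in D) f x = \sum_(k <oo) \int[P]_(x in D `&` Z @^-1` [set k]) f x.
Proof.
move=> mZ mD mf f0.
have DE : D = \bigcup_k (D `&` Z @^-1` [set k]).
  by rewrite -setI_bigcupr -preimage_bigcup bigcup_imset1 image_id preimage_setT setIT.
rewrite {1}DE ge0_integral_bigcup//.
- by move=> k; exact: measurableI.
- exact: measurable_funTS.
- by move=> i j _ _ [w [[_ <-] [_ <-]]].
Qed.

Lemma eq_integral_fibers (C : countType) (Z : T -> C) (f g : T -> \bar R) :
  measurable_fibers Z -> measurable_fun setT f -> measurable_fun setT g ->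
  (forall x, 0 <= f x) -> (forall x, 0 <= g x) ->
  (forall c, \int[P]_(x in Z @^-1` [set c]) f x = \int[P]_(x in Z @^-1` [set c]) g x) ->
  \int[P]_x f x = \int[P]_x g x.
Proof.
move=> mZ mf mg f0 g0 fg; have mpZ := measurable_fibers_pickle mZ.
rewrite (ge0_integral_fibers mpZ)// (ge0_integral_fibers mpZ)//.
apply: eq_eseriesr => k _; rewrite setTI.
have [[w Zw]|Zk] := pselect (exists w, pickle (Z w) = k).
  have -> : (pickle \o Z) @^-1` [set k] = Z @^-1` [set Z w]; last exact: fg.
  by apply/seteqP; split=> x /= => [|->//]; rewrite -Zw => /(pcan_inj pickleK).
have -> : (pickle \o Z) @^-1` [set k] = set0; last by rewrite !integral_set0.
by apply/seteqP; split=> x //= xk; apply: Zk; exists x.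
Qed.

Lemma integral_fiber_cst (C : Type) (Z : T -> C) (D : set T) (h : C -> R)
    (f : T -> R) (c : C) :
  measurable_fibers Z -> measurable D -> measurable_fun setT f ->
  (forall x, 0 <= f x)%R -> (0 <= h c)%R ->
  \int[P]_(x in D `&` Z @^-1` [set c]) (f x * h (Z x))%:E =
  (h c)%:E * \int[P]_(x in D `&` Z @^-1` [set c]) (f x)%:E.
Proof.
move=> mZ mD mf f0 h0.
under eq_integral => x /set_mem [_ /= ->] do rewrite mulrC EFinM.
rewrite ge0_integralZl_EFin//; first exact: measurableI.
- by move=> x _; rewrite lee_fin.
- by apply/measurable_EFinP; exact: measurable_funTS.
Qed.

Lemma ge0_integral_comp_fibers (Z : T -> nat) (h : nat -> R) :
  measurable_fibers Z -> (forall k, 0 <= h k)%R ->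
  \int[P]_x (h (Z x))%:E = \sum_(k <oo) (h k)%:E * P (Z @^-1` [set k]).
Proof.
move=> mZ h0.
rewrite (ge0_integral_fibers mZ)//; first last.
- by move=> x; rewrite lee_fin.
- by apply/measurable_EFinP; exact: (measurable_fun_fibers h mZ).
apply: eq_eseriesr => k _.
transitivity (\int[P]_(x in setT `&` Z @^-1` [set k]) (cst 1 x * h (Z x))%:E).
  by apply: eq_integral => x _; rewrite mul1r.
rewrite integral_fiber_cst//.
rewrite setTI; congr (_ * _).
by rewrite -[LHS]/(\int[P]_(x in Z @^-1` [set k]) cst 1 x) integral_cst ?mul1e.
Qed.

End Fibers.

Lemma eq_integral_law d (T : measurableType d) d' (T' : measurableType d')
    (R : realType) (P : probability T R) (P' : probability T' R) (C : countType)
    (Z : T -> C) (Z' : T' -> C) (h : C -> R) :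
  measurable_fibers Z -> measurable_fibers Z' ->
  (forall c, P (Z @^-1` [set c]) = P' (Z' @^-1` [set c])) ->
  (forall c, 0 <= h c) ->
  (\int[P]_x (h (Z x))%:E = \int[P']_x (h (Z' x))%:E)%E.
Proof.
move=> mZ mZ' ZZ' h0.
have mpZ := measurable_fibers_pickle mZ; have mpZ' := measurable_fibers_pickle mZ'.
(* [h] read through the encoding by naturals; the default 0 is taken only at numbers that encode
   nothing. *)
pose h' k := if @pickle_inv C k is Some c then h c else 0.
have hE c : h c = h' (pickle c) by rewrite /h' pickleK_inv.
have h'0 k : 0 <= h' k by rewrite /h'; case: pickle_inv.
under eq_integral do rewrite hE; under [RHS]eq_integral do rewrite hE.
rewrite (ge0_integral_comp_fibers (Z := pickle \o Z))//.
rewrite (ge0_integral_comp_fibers (Z := pickle \o Z'))//.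
apply: eq_eseriesr => k _; rewrite /h'; case E : (@pickle_inv C k) => [c|];
  last by rewrite !mul0e.
have pc : pickle c = k by have := @pickle_invK C k; rewrite E.
have fibE (U : Type) (W : U -> C) : (pickle \o W) @^-1` [set k] = W @^-1` [set c].
  by apply/seteqP; split=> x /=; rewrite -pc; [move/(pcan_inj pickleK)|move=> ->].
by rewrite !fibE ZZ'.
Qed.

(** * Uniqueness of the coefficients of a generating function *)

Section PgfInjective.
Context (R : realType).
Implicit Types a b : nat -> \bar R.
Local Open Scope ereal_scope.

Let eq_pgf a b := forall t : R, (0 < t <= 1)%R ->
  \sum_(k <oo) a k * (t ^+ k)%:E = \sum_(k <oo) b k * (t ^+ k)%:E.

Let term_ge0 (x : \bar R) (t : R) k : 0 <= x -> (0 < t)%R -> 0 <= x * (t ^+ k)%:E.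
Proof. by move=> x0 t0; rewrite mule_ge0// lee_fin exprn_ge0// ltW. Qed.

Let pgf_recl a (t : R) : (forall k, 0 <= a k) -> (0 < t)%R ->
  \sum_(k <oo) a k * (t ^+ k)%:E =
  a 0%N + t%:E * \sum_(k <oo) a k.+1 * (t ^+ k)%:E.
Proof.
move=> a0 t0; rewrite nneseries_recl//; last by move=> k _; exact: term_ge0.
rewrite expr0 mule1; congr (_ + _); rewrite -nneseriesZl; last first.
  by move=> k _; exact: term_ge0.
rewrite -(nneseries_addn 1); last by move=> k; exact: term_ge0.
by apply: eq_eseriesr => k _; rewrite addn1 exprS EFinM muleCA.
Qed.

Let sum_at1 a : \sum_(k <oo) a k * (1 ^+ k)%:E = \sum_(k <oo) a k.
Proof. by apply: eq_eseriesr => k _; rewrite expr1n mule1. Qed.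

(** Let t tend to 0: a_0 is at most the common value at t, which is at most b_0 + t M with M the sum
    of the later coefficients of [b]. *)
Let pgf_head_le a b : (forall k, 0 <= a k) -> (forall k, 0 <= b k) ->
  \sum_(k <oo) b k < +oo -> eq_pgf a b -> a 0%N <= b 0%N.
Proof.
move=> a0 b0 bfin ab.
have tail_ge0 c (t : R) : (forall k, 0 <= c k) -> (0 < t)%R ->
    0 <= \sum_(k <oo) c k.+1 * (t ^+ k)%:E.
  by move=> c0 t0; apply: nneseries_ge0 => k _ _; exact: term_ge0.
pose M := \sum_(k <oo) b k.+1.
have bE : \sum_(k <oo) b k = b 0%N + M.
  by rewrite -sum_at1 pgf_recl// mul1e (sum_at1 (b \o S)).
have M0 : 0 <= M by apply: nneseries_ge0 => k _ _.
have Mfin : M \is a fin_num.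
  by rewrite ge0_fin_numE// (le_lt_trans _ bfin)// bE leeDr.
apply/lee_addgt0Pr => eps eps0.
(* This makes t M at most [eps]; adding 1 to M keeps the denominator positive. *)
pose t : R := Num.min 1%R (eps / (fine M + 1))%R.
have M1 : (0 < fine M + 1)%R by rewrite ltr_wpDl// fine_ge0.
have t0 : (0 < t)%R by rewrite lt_min ltr01 divr_gt0.
have t1 : (t <= 1)%R by rewrite ge_min lexx.
have := ab t; rewrite t0 t1 => /(_ isT); rewrite (pgf_recl a0 t0) (pgf_recl b0 t0)
  => abt.
apply: (@le_trans _ _ (b 0%N + t%:E * \sum_(k <oo) b k.+1 * (t ^+ k)%:E)).
  by rewrite -abt leeDl// mule_ge0// ?tail_ge0// lee_fin ltW.
rewrite leeD2l//; apply: (@le_trans _ _ (t%:E * M)).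
  rewrite lee_pmul2l// ?lte_fin//; apply: lee_nneseries => k _.
    by move=> _; exact: term_ge0.
  by rewrite -[leRHS]mule1 lee_wpmul2l// lee_fin exprn_ile1// ltW.
rewrite -(fineK Mfin) -EFinM lee_fin.
apply: (@le_trans _ _ (t * (fine M + 1))%R); first by rewrite ler_wpM2l ?(ltW t0)//
  lerDl.
by rewrite -ler_pdivlMr// ge_min lexx orbT.
Qed.

(** The first coefficients agree by [pgf_head_le] used both ways. Subtracting them and dividing by t
    leaves the same equation for the shifted sequences. Finite sums allow the subtraction; for [b]
    finiteness comes from t = 1. *)
Lemma pgf_inj a b : (forall k, 0 <= a k) -> (forall k, 0 <= b k) ->
  \sum_(k <oo) a k < +oo -> eq_pgf a b -> a =1 b.
Proof.
move=> a0 b0 afin ab k; elim: k a b a0 b0 afin ab => [|k IHk] a b a0 b0 afin ab.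
  have bfin : \sum_(k <oo) b k < +oo by rewrite -sum_at1 -ab ?sum_at1// ltr01 lexx.
  by apply/eqP; rewrite eq_le !pgf_head_le// => t /ab.
have a0fin : a 0%N \is a fin_num.
  by rewrite ge0_fin_numE// (le_lt_trans _ afin)// -sum_at1 pgf_recl// leeDl//
    mul1e nneseries_ge0// => *; exact: term_ge0.
have bfin : \sum_(k <oo) b k < +oo by rewrite -sum_at1 -ab ?sum_at1// ltr01 lexx.
have ab0 : a 0%N = b 0%N.
  by apply/eqP; rewrite eq_le !pgf_head_le// => t /ab.
apply: (IHk (a \o S) (b \o S)) => //=.
  apply: le_lt_trans afin; rewrite -[leRHS]sum_at1 pgf_recl// mul1e (sum_at1 (a \o S)).
  by rewrite leeDr.
move=> t t01; have /andP[t0 _] := t01; have := ab t t01.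
rewrite (pgf_recl a0 t0) (pgf_recl b0 t0) -ab0 => /(congr1 (fun x => x - a 0%N)).
rewrite !(addeC (a 0%N)) !addeK// => /(congr1 (fun x => (t^-1)%:E * x)).
by rewrite !muleA -EFinM mulVf ?gt_eqF// !mul1e.
Qed.

End PgfInjective.

Lemma expR_nneseries (R : realType) (x : R) :
  (expR x)%:E = (\sum_(k <oo) (x ^+ k / k`!%:R)%:E)%E.
Proof.
rewrite /expR -EFin_lim; last exact: is_cvg_series_exp_coeff.
by apply/congr_lim/funext => k; rewrite /series /= -sumEFin.
Qed.

Section IntegralPgf.
Context d (T : measurableType d) (R : realType) (P : probability T R).
Local Open Scope ereal_scope.

Lemma integral_expr_fibers (Z : T -> nat) (f : T -> R) (t : R) :
  measurable_fibers Z -> measurable_fun setT f -> (forall x, 0 <= f x)%R -> (0 <=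
    t)%R ->
  \int[P]_x (f x * t ^+ Z x)%:E =
  \sum_(k <oo) (\int[P]_(x in Z @^-1` [set k]) (f x)%:E) * (t ^+ k)%:E.
Proof.
move=> mZ mf f0 t0; rewrite (ge0_integral_fibers mZ)//; first last.
- by move=> x; rewrite lee_fin mulr_ge0// exprn_ge0.
- apply/measurable_EFinP; apply: measurable_funM => //.
  exact: (measurable_fun_fibers (fun k => t ^+ k)%R mZ).
apply: eq_eseriesr => k _.
by rewrite (integral_fiber_cst (h := fun k => (t ^+ k)%R))// ?exprn_ge0// setTI muleC.
Qed.

(** The coefficients are the masses of the fibers under the measures of densities [f] and [g], whose
    total mass may differ from 1. In the application [f] is X_v and [g] is constant. *)
Lemma pgf_integral_inj (Z W : T -> nat) (f g : T -> R) :
  measurable_fibers Z -> measurable_fibers W ->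
  measurable_fun setT f -> measurable_fun setT g ->
  (forall x, 0 <= f x)%R -> (forall x, 0 <= g x)%R ->
  \int[P]_x (f x)%:E < +oo ->
  (forall t : R, (0 < t <= 1)%R ->
     \int[P]_x (f x * t ^+ Z x)%:E = \int[P]_x (g x * t ^+ W x)%:E) ->
  forall k, \int[P]_(x in Z @^-1` [set k]) (f x)%:E =
            \int[P]_(x in W @^-1` [set k]) (g x)%:E.
Proof.
move=> mZ mW mf mg f0 g0 ffin fg; apply: pgf_inj.
- by move=> k; apply: integral_ge0 => x _; rewrite lee_fin.
- by move=> k; apply: integral_ge0 => x _; rewrite lee_fin.
- rewrite (ge0_integral_fibers mZ)// in ffin.
  + by under eq_eseriesr do rewrite -[X in \int[_]_(_ in X) _]setTI.
  + exact/measurable_EFinP.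
- by move=> t t01; have /andP[/ltW t0 _] := t01; rewrite -!integral_expr_fibers// fg.
Qed.

Lemma poisson_pgf (L : {RV P >-> nat}) (rate t : R) :
  distribution P L =1 poisson_prob rate 0%N -> (0 <= rate)%R -> (0 <= t)%R ->
  \int[P]_x (t ^+ L x)%:E = (expR (rate * (t - 1)))%:E.
Proof.
move=> dL rate0 t0.
have mL : measurable_fibers L by exact: measurable_fibers_rv.
rewrite (ge0_integral_comp_fibers (h := fun k => (t ^+ k)%R))//; last by move=> k;
  exact: exprn_ge0.
have PL k : P (L @^-1` [set k]) = poisson_prob rate 0%N [set k] by rewrite -dL.
under eq_eseriesr do rewrite PL /poisson_prob.
(* At rate 0 the law is a Dirac mass instead of being given by [poisson_pmf]; this can occur for an
   innovation when alpha reaches its upper bound. *)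
move: rate0; rewrite le_eqVlt => /predU1P[<-|rate0].
  rewrite ltxx mul0r expR0 nneseries_recl//; last first.
    by move=> k _; rewrite mule_ge0// lee_fin exprn_ge0.
  rewrite expr0 diracE mem_set// mule1 eseries0 ?adde0// => i i0 _.
  rewrite diracE memNset ?mule0//= => i0'; by rewrite -i0' in i0.
rewrite rate0.
under eq_eseriesr => k _.
  rewrite esum_set1 ?lee_fin ?poisson_pmf_ge0// /poisson_pmf rate0.
  rewrite -EFinM [X in X%:E](_ : _ = (expR (- rate) * ((rate * t) ^+ k /
    k`!%:R))%R); last first.
    rewrite exprMn; move: (t ^+ k)%R (rate ^+ k)%R (expR _) (_^-1)%R => a b c e; ring.
  rewrite EFinM; over.
rewrite nneseriesZl; last first.
  by move=> k _; rewrite lee_fin divr_ge0// exprn_ge0// mulr_ge0// ltW.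
by rewrite mulrBr mulr1 addrC expRD EFinM -expR_nneseries.
Qed.

Lemma bernoulli_pgf (X : {RV P >-> bool}) (p t : R) :
  distribution P X =1 bernoulli_prob p -> (0 <= p <= 1)%R -> (0 <= t)%R ->
  \int[P]_x (t ^+ X x)%:E = (1 - p + p * t)%:E.
Proof.
move=> dX p01 t0.
have mX : measurable_fibers X by exact: measurable_fibers_rv.
pose Z : T -> nat := fun x => X x.
have mZ : measurable_fibers Z.
  by move=> k; exact: (measurable_fibers_comp nat_of_bool mX).
rewrite (ge0_integral_comp_fibers (Z := Z) (h := fun k => (t ^+ k)%R))//;
  last by move=> k; exact: exprn_ge0.
have PX b : P (X @^-1` [set b]) = (bernoulli_pmf p b)%:E.
  rewrite -[LHS]/(distribution P X [set b]) dX /bernoulli_prob p01.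
  by rewrite fsbig_set1.
have Z0 : Z @^-1` [set 0%N] = X @^-1` [set false].
  by apply/seteqP; split=> x; rewrite /Z /=; case: (X x).
have Z1 : Z @^-1` [set 1%N] = X @^-1` [set true].
  by apply/seteqP; split=> x; rewrite /Z /=; case: (X x).
have Z2 k : Z @^-1` [set k.+2] = set0.
  by apply/seteqP; split=> x; rewrite /Z /=; case: (X x).
rewrite (nneseries_split 0 2); last by move=> k; rewrite mule_ge0// lee_fin exprn_ge0.
rewrite /= big_mkord !big_ord_recr big_ord0 /= add0e Z0 Z1 !PX /= expr0 expr1 mul1e.
rewrite eseries0 ?adde0; first by rewrite -EFinM -EFinD mulrC.
by move=> [|[|k]]//= _ _; rewrite Z2 measure0 mule0.
Qed.

End IntegralPgf.

(** * Independence *)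

(** The constant may be infinite because [indep_fun] does not ask for an integrable function. *)
Lemma nneseriesZl_ereal (R : realType) (x : nat -> \bar R) (c : \bar R) :
  (0 <= c)%E -> (forall k, 0 <= x k)%E ->
  (\sum_(k <oo) c * x k = c * \sum_(k <oo) x k)%E.
Proof.
case: c => [c| |]// c0 x0; first by rewrite nneseriesZl.
have [x00|/existsNP[k /eqP xk]] := pselect (forall k, x k = 0%E).
  by rewrite !eseries0 ?mule0// => k _ _; rewrite x00 ?mule0.
have xk0 : (0 < x k)%E by rewrite lt_def xk x0.
have yx0 i : (0 <= +oo * x i)%E by rewrite mule_ge0.
rewrite [LHS](nneseriesD1 (n := k))// gt0_mulye// addye.
  rewrite gt0_mulye//; apply: (lt_le_trans xk0).
  by rewrite (nneseriesD1 (n := k))// leeDl// nneseries_ge0.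
by rewrite gt_eqF// (lt_le_trans (ltNyr 0))// nneseries_ge0.
Qed.

Lemma integral_setI_indic d (T : measurableType d) (R : realType)
    (mu : {measure set T -> \bar R}) (D A : set T) (f : T -> R) :
  (\int[mu]_(x in D `&` A) (f x)%:E = \int[mu]_(x in D) (f x * \1_A x)%:E)%E.
Proof.
by rewrite integral_mkcondr epatch_indic; apply: eq_integral => x _; rewrite EFinM.
Qed.

Lemma integral_fiber_eq d (T : measurableType d) (R : realType)
    (mu : {measure set T -> \bar R}) (C : eqType) (Z : T -> C) (D : set T)
    (f : T -> R) (c : C) :
  (\int[mu]_(x in D `&` Z @^-1` [set c]) (f x)%:E =
   \int[mu]_(x in D) (f x * (Z x == c)%:R)%:E)%E.
Proof.
rewrite integral_setI_indic; apply: eq_integral => x _.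
rewrite indicE; congr (_ * (nat_of_bool _)%:R)%:E.
by apply/idP/eqP => [/set_mem//|Zk]; exact/mem_set.
Qed.

Section IndependentFunctions.
Context {d} {T : measurableType d} {R : realType} {P : probability T R}.
Context {I : choiceType} {F : I -> set (set T)}.
Hypothesis F_measurable : forall i A, F i A -> measurable A.

(* A weak form of independence of f from the F i, i in J, which involves f only
   through its integral; multiplication by functions of the remaining variables
   preserves it. *)
Definition indep_fun (f : T -> R) (J : set I) : Prop :=
  [/\ measurable_fun setT f, forall x, 0 <= f x &
      forall (s : seq I) (E : I -> set T), uniq s ->
        (forall i, i \in s -> J i /\ F i (E i)) ->
        (\int[P]_(x in \big[setI/setT]_(i <- s) E i) (f x)%:E =
         (\prod_(i <- s) P (E i)) * \int[P]_x (f x)%:E)%E].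

Let measurable_bigsetI (s : seq I) (E : I -> set T) (J : set I) :
  (forall i, i \in s -> J i /\ F i (E i)) ->
  measurable (\big[setI/setT]_(i <- s) E i).
Proof.
move=> sE; rewrite big_seq.
apply: (big_ind measurable) => // [|i /sE[_ /F_measurable]//].
exact: measurableI.
Qed.

Lemma indep_fun1 (D : set I) :
  mutual_independence P D F -> indep_fun (cst 1) D.
Proof.
move=> PDF; split => // s E us sE.
have mE := measurable_bigsetI sE.
have -> : (\int[P]_x (@cst T R 1 x)%:E = 1)%E.
  rewrite -[LHS]/(\int[P]_x cst 1 x)%E integral_cst// mul1e.
  exact: probability_setT.
rewrite -[LHS]/(\int[P]_(x in _) cst 1 x)%E integral_cst// mul1e mule1.
pose J := finmap.seq_fset tt s.
have sJ i : (i \in J) = (i \in s) by rewrite finmap.seq_fsetE.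
have -> : \big[setI/setT]_(i <- s) E i = \bigcap_(i in [set` J]) E i.
  by rewrite -bigcap_seq; apply: eq_bigcapl; split=> i /=; rewrite sJ.
transitivity (\prod_(i <- finmap.enum_fset J) P (E i))%E.
  by apply: PDF => i /=; rewrite sJ => /sE[].
apply: perm_big; rewrite -[X in perm_eq _ X]undup_id//.
exact: finmap.seq_fset_perm.
Qed.

Lemma indep_fun_sub (f : T -> R) (J J' : set I) :
  J' `<=` J -> indep_fun f J -> indep_fun f J'.
Proof.
move=> JJ' [mf f0 fJ]; split => // s E us sE; apply: fJ => // i /sE[J'i FE].
by split => //; exact: JJ'.
Qed.

(** Prescribing [A] at the new index [c] turns an intersection with [A] into a product rule over
    [c :: s]. *)
Let cons_event (c : I) (A : set T) (E : I -> set T) (i : I) : set T :=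
  if i == c then A else E i.

Let big_cons_event (V : Type) (idx : V) (op : V -> V -> V) (g : set T -> V)
    (c : I) (A : set T) (E : I -> set T) (s : seq I) : c \notin s ->
  \big[op/idx]_(i <- c :: s) g (cons_event c A E i) =
  op (g A) (\big[op/idx]_(i <- s) g (E i)).
Proof.
move=> cs; rewrite big_cons {1}/cons_event eqxx; congr op.
rewrite big_seq [RHS]big_seq; apply: eq_bigr => i si; rewrite /cons_event.
by case: eqP => // ic; rewrite -ic si in cs.
Qed.

Let cons_eventP (c : I) (A : set T) (E : I -> set T) (J : set I) (s : seq I) :
  J c -> F c A -> (forall i, i \in s -> (J `\ c) i /\ F i (E i)) ->
  c \notin s /\
  forall i, i \in c :: s -> J i /\ F i (cons_event c A E i).
Proof.
move=> Jc FA sE; split; first by apply/negP => /sE[[_ /=]].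
move=> i; rewrite in_cons /cons_event => /predU1P[->|/sE[[Ji /eqP/negbTE ->]]//].
by rewrite eqxx.
Qed.

Lemma indep_fun_indic (f : T -> R) (J : set I) (c : I) (A : set T) :
  indep_fun f J -> J c -> F c A -> indep_fun (fun x => f x * \1_A x) (J `\ c).
Proof.
move=> [mf f0 fJ] Jc FA; have mA := F_measurable FA.
have int_indic D : measurable D ->
    (\int[P]_(x in D) (f x * \1_A x)%:E = \int[P]_(x in A `&` D) (f x)%:E)%E.
  by move=> mD; rewrite setIC integral_setI_indic.
split.
- by apply: measurable_funM => //; exact: measurable_indic.
- by move=> x; rewrite mulr_ge0.
- move=> s E us sE; have [cs csE] := cons_eventP Jc FA sE.
  rewrite !int_indic//; last exact: (measurable_bigsetI sE).
  rewrite -(@big_cons_event _ setT setI id c A E)// fJ//=; last by rewrite cs.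
  rewrite (@big_cons_event _ 1%E mule P)// setIT.
  have := fJ [:: c] (cons_event c A E); rewrite !big_seq1 /cons_event eqxx => ->//.
    by rewrite muleA (muleC (P A)).
  by move=> i; rewrite inE => /eqP ->; rewrite eqxx.
Qed.

(** On each fiber of [Z], an event of [F c], the rule for [f] applies to the family extended by [c];
    summing over the fibers gives the product. The index [c] is spent and leaves [J]. *)
Lemma indep_funM (f : T -> R) (J : set I) (c : I) (Z : T -> nat) (h : nat -> R) :
  indep_fun f J -> J c -> (forall k, F c (Z @^-1` [set k])) ->
  (forall k, 0 <= h k) ->
  (\int[P]_x (f x * h (Z x))%:E = \int[P]_x (f x)%:E * \int[P]_x (h (Z x))%:E)%E
  /\ indep_fun (fun x => f x * h (Z x)) (J `\ c).
Proof.
move=> [mf f0 fJ] Jc FZ h0.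
have mZ : measurable_fibers Z by move=> k; exact: F_measurable (FZ k).
have mfh : measurable_fun setT (fun x => f x * h (Z x)).
  by apply: measurable_funM => //; exact: (measurable_fun_fibers h mZ).
have key s E : uniq s -> (forall i, i \in s -> (J `\ c) i /\ F i (E i)) ->
    (\int[P]_(x in \big[setI/setT]_(i <- s) E i) (f x * h (Z x))%:E =
     (\prod_(i <- s) P (E i)) * (\int[P]_x (f x)%:E * \int[P]_x (h (Z x))%:E))%E.
  move=> us sE; have mE := measurable_bigsetI sE.
  rewrite (ge0_integral_fibers mZ)//; first last.
  - by move=> x; rewrite lee_fin mulr_ge0.
  - exact/measurable_EFinP.
  have intf0 : (0 <= \int[P]_x (f x)%:E)%E.
    by apply: integral_ge0 => x _; rewrite lee_fin.
  rewrite (ge0_integral_comp_fibers mZ)// muleA -nneseriesZl_ereal; first last.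
  - by move=> k; rewrite mule_ge0// lee_fin.
  - by rewrite mule_ge0// prode_ge0.
  apply: eq_eseriesr => k _; rewrite integral_fiber_cst//.
  have [cs csE] := cons_eventP Jc (FZ k) sE.
  rewrite setIC -(@big_cons_event _ setT setI id c (Z @^-1` [set k]) E)// fJ//=;
    last by rewrite cs.
  by rewrite (@big_cons_event _ 1%E mule P)// [RHS]muleC !muleA.
split; first by have := key [::] (fun=> set0); rewrite !big_nil mul1e => ->.
split => //; first by move=> x; rewrite mulr_ge0.
move=> s E us sE; rewrite key//; congr (_ * _)%E.
by have := key [::] (fun=> set0); rewrite !big_nil mul1e => ->.
Qed.

(** Independence may be checked on one fiber at a time, where a random number of factors becomes
    constant. *)
Lemma indep_fun_fibers (f : T -> R) (J : set I) (Z : T -> nat) :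
  measurable_fibers Z -> measurable_fun setT f -> (forall x, 0 <= f x) ->
  (forall k, indep_fun (fun x => f x * (Z x == k)%:R) J) -> indep_fun f J.
Proof.
move=> mZ mf f0 fZ; split => // s E us sE.
have mE := measurable_bigsetI sE.
have mef : measurable_fun setT (EFin \o f) by exact/measurable_EFinP.
rewrite (ge0_integral_fibers mZ)// [in RHS](ge0_integral_fibers mZ)//.
rewrite -nneseriesZl_ereal; first last.
- by move=> k; apply: integral_ge0 => x _; rewrite lee_fin.
- by rewrite prode_ge0.
apply: eq_eseriesr => k _; rewrite !integral_fiber_eq.
by have [_ _ ->] := fZ k.
Qed.

Lemma integral_indep_prod (K : eqType) (s : seq K) (c : K -> I) (Z : K -> T -> nat)
    (h : K -> nat -> R) (f : T -> R) (J : set I) :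
  indep_fun f J -> uniq (map c s) -> (forall k, k \in s -> J (c k)) ->
  (forall k m, k \in s -> F (c k) (Z k @^-1` [set m])) ->
  (forall k m, 0 <= h k m) ->
  (\int[P]_x (f x * \prod_(k <- s) h k (Z k x))%:E =
   \int[P]_x (f x)%:E * \prod_(k <- s) \int[P]_x (h k (Z k x))%:E)%E.
Proof.
move=> + + + + h0; elim: s f J => [|k s IHs] f J fJ /=.
  by rewrite big_nil mule1 => _ _ _; under eq_integral do rewrite big_nil mulr1.
move=> /andP[cks us] sJ sF.
have [intfk fkJ] := indep_funM fJ (sJ k (mem_head _ _)) (fun m => sF k m (mem_head
  _ _)) (h0 k).
under eq_integral do rewrite big_cons mulrA.
rewrite (IHs _ _ fkJ)// ?big_cons ?intfk ?muleA//; last first.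
  by move=> k' m sk'; apply: sF; rewrite in_cons sk' orbT.
move=> k' sk'; split; first by apply: sJ; rewrite in_cons sk' orbT.
by move=> /= ckk; rewrite -ckk map_f in cks.
Qed.

(* A stands for an event on which the random numbers of factors are equal to
   the a u. *)
Lemma integral_compound_prod n (D : set I) (c0 : I) (A : set T)
    (c : 'I_n * nat -> I) (Z : 'I_n * nat -> T -> nat) (h : 'I_n * nat -> nat -> R)
    (a : 'I_n -> nat) :
  mutual_independence P D F -> D c0 -> F c0 A ->
  injective c -> (forall k, c k != c0) -> (forall k, D (c k)) ->
  (forall k m, F (c k) (Z k @^-1` [set m])) -> (forall k m, 0 <= h k m) ->
  (\int[P]_(x in A) (\prod_u \prod_(j < a u) h (u, (j : nat)) (Z (u, (j : nat)) x))%:E =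
   P A * \prod_u \prod_(j < a u) \int[P]_x (h (u, (j : nat)) (Z (u, (j : nat))
     x))%:E)%E.
Proof.
move=> PD Dc0 FA cinj cc0 Dc FZ h0; have mA := F_measurable FA.
pose s := [seq (u, j) | u <- index_enum 'I_n, j <- iota 0 (a u)].
(* Any monoid law is allowed because the double product is flattened both in [R] and in the extended
   reals. *)
have sE (V : Type) (idx : V) (op : Monoid.law idx) (g : 'I_n * nat -> V) :
    \big[op/idx]_u \big[op/idx]_(j < a u) g (u, (j : nat)) = \big[op/idx]_(k <- s) g k.
  rewrite /s big_allpairs_dep; apply: eq_bigr => u _.
  by rewrite -(big_mkord xpredT (fun j => g (u, j))) /index_iota subn0.
under eq_integral do rewrite (sE _ _ _ (fun k => h k (Z k _))).
rewrite (sE _ _ _ (fun k => \int[P]_x (h k (Z k x))%:E)%E).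
have := indep_fun_indic (indep_fun1 PD) Dc0 FA.
move=> /(@integral_indep_prod _ s c Z h) H.
have us : uniq (map c s).
  rewrite map_inj_uniq//; apply: allpairs_uniq_dep; first exact: index_enum_uniq.
    by move=> u _; exact: iota_uniq.
  by move=> [? ?] [? ?] _ _ [-> ->].
transitivity (\int[P]_x (cst 1 x * \1_A x * \prod_(k <- s) h k (Z k x))%:E)%E.
  rewrite -{1}[A]setTI integral_setI_indic; apply: eq_integral => x _.
  by rewrite mul1r mulrC.
rewrite H//; last by move=> k _; split => //; exact/eqP/cc0.
congr (_ * _)%E; under eq_integral do rewrite mul1r.
by rewrite integral_indic// setIT.
Qed.

End IndependentFunctions.

Arguments indep_fun {d T R} P {I} F f J.

(** * The generating function of the MPMRF *)

Section ParentClosed.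
Context (V : finType) (e : rel V) (r : V).
Hypothesis tree_e : is_tree e.

(** The subtrees containing the root, that is, the vertex sets left while leaves are peeled off. *)
Definition parent_closed (A : {set V}) : Prop :=
  r \in A /\ forall u, u \in A -> u != r -> pa e r u \in A.

(** A vertex of maximal rank among those other than the root has no child in the set, so the set
    stays closed without it. *)
Lemma parent_closed_ind (Q : {set V} -> Prop) :
  Q [set r]%SET ->
  (forall A c, parent_closed A -> c \notin A -> c != r -> pa e r c \in A ->
     Q A -> Q (c |: A)%SET) ->
  forall A, parent_closed A -> Q A.
Proof.
move=> Q1 QU A; have [rank rankP] := pa_rank tree_e r.
have [m] := ubnP #|A|; elim: m A => // m IHm A Am [rA clA].
have [->//|/set0Pn[c0]] : A = [set r]%SET \/ (A :\ r != finset.set0)%SET.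
- have [A0|] := eqVneq (A :\ r)%SET finset.set0; [left|by right].
  by rewrite -(finset.setD1K rA) A0 finset.setU0.
- move=> c0A; pose c := [arg max_(c > c0 in (A :\ r)%SET) rank c].
  have [cA cmax] : c \in (A :\ r)%SET /\ forall u, u \in (A :\ r)%SET -> (rank u <=
    rank c)%N.
    by rewrite /c; case: arg_maxnP => // c' cA' cmax; split.
  have {cA}[cr cA] : c != r /\ c \in A by move: cA; rewrite finset.in_setD1 => /andP[].
  have clAc : parent_closed (A :\ c)%SET.
    split=> [|u]; first by rewrite finset.in_setD1 eq_sym cr.
    rewrite !finset.in_setD1 => /andP[uc uA] ur; rewrite clA// andbT.
    apply/eqP => pu; have := rankP u ur; rewrite pu ltnNge cmax//.
    by rewrite finset.in_setD1 ur.
  rewrite -(finset.setD1K cA); apply: QU => //; first by rewrite finset.in_setD1 eqxx.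
    rewrite finset.in_setD1 clA// andbT; apply/eqP => pc.
    by have := rankP c cr; rewrite pc ltnn.
  by apply: IHm => //; move: Am; rewrite (cardsD1 c) cA.
Qed.

Lemma parent_closedT : parent_closed [set: V]%SET.
Proof. by split=> *; rewrite finset.in_setT. Qed.

End ParentClosed.

Lemma sigma_rv_preimage d (T : measurableType d) (R : realType) (P : probability T R)
    d' (T' : measurableType d') (X : {RV P >-> T'}) (A : set T') :
  measurable A -> sigma_rv X (X @^-1` A).
Proof. by move=> mA; exists A => //; rewrite setTI. Qed.

Lemma sigma_rv_measurable d (T : measurableType d) (R : realType) (P : probability T R)
    d' (T' : measurableType d') (X : {RV P >-> T'}) (A : set T) :
  sigma_rv X A -> measurable A.
Proof. by move=> [B mB <-]; exact: measurable_funP. Qed.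

Section RootedPgf.
Context (n : nat) (R : realType) (e : rel 'I_n).
Context (lambda : 'I_n -> R) (alpha : 'I_n -> 'I_n -> R).
Hypotheses (tree_e : is_tree e) (adm : admissible e lambda alpha).
Context d (T : measurableType d) (P : probability T R).
Context (r : 'I_n) (L : 'I_n -> {RV P >-> nat}) (Bern : 'I_n -> nat -> {RV P >-> bool}).
Context (N : 'I_n -> {RV P >-> nat}).
Hypothesis constr :
  MPMRF_construction e lambda alpha r L Bern (fun v => N v : T -> nat).

Local Notation theta := (thinning_prob e lambda alpha r).
Local Notation rate := (innovation_rate e lambda alpha r).

Let F (k : 'I_n + 'I_n * nat) : set (set T) :=
  match k with inl v => sigma_rv (L v) | inr (v, j) => sigma_rv (Bern v j) end.

Let Z (k : 'I_n + 'I_n * nat) : T -> nat :=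
  match k with inl v => L v | inr (v, j) => fun x => Bern v j x end.

Let F_measurable k A : F k A -> measurable A.
Proof. by case: k => [v|[v j]]; exact: sigma_rv_measurable. Qed.

Let FZ k m : F k (Z k @^-1` [set m]).
Proof.
case: k => [v|[v j]] /=; first exact: sigma_rv_preimage.
exact: (@sigma_rv_preimage _ _ _ _ _ _ (Bern v j) [set b : bool | b = m :> nat]).
Qed.

Let mN u : measurable_fibers (N u).
Proof. exact: measurable_fibers_rv. Qed.

(** The primitive variables from which no [N u] with [u] in [A] is built, among those that the
    construction declares independent. *)
Let outside (A : {set 'I_n}) : set ('I_n + 'I_n * nat) :=
  [set k | match k with
           | inl u => u \notin A
           | inr (u, _) => (u \notin A) && (u != r)
           end].

(** A new vertex [c] whose parent has value [k]. The Bernoulli variables are split off one by one: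
    on the event that the last one equals [b], it is absorbed into [h] as a shift. *)
Let indep_fun_node c k g J J' (h : nat -> R) : indep_fun P F g J ->
  J' `<=` J -> J (inl c) -> ~ J' (inl c) ->
  (forall j, (j < k)%N -> J (inr (c, j)) /\ ~ J' (inr (c, j))) ->
  (forall m, 0 <= h m) ->
  indep_fun P F (fun x => g x * h (\sum_(j < k) Bern c j x + L c x)%N) J'.
Proof.
move=> gJ J'J Jc J'c + h0; elim: k g J h gJ J'J Jc h0 => [|k IHk] g J h gJ J'J Jc h0 kJ.
  have -> : (fun x => g x * h (\sum_(j < 0) Bern c j x + L c x)%N) =
            (fun x => g x * h (Z (inl c) x)).
    by apply/funext => x; rewrite big_ord0.
  have [_] := indep_funM F_measurable gJ Jc (FZ (inl c)) h0.
  by apply: indep_fun_sub => i J'i; split; [exact: J'J|move=> ic; rewrite ic in J'i].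
have [Jk J'k] := kJ k (ltnSn k).
have [mg g0 _] := gJ.
have mZk : measurable_fibers (Z (inr (c, k))).
  by move=> m; exact: F_measurable (FZ (inr (c, k)) m).
apply: (indep_fun_fibers F_measurable mZk).
- apply: measurable_funM => //; apply: (measurable_fun_fibers h).
  apply: measurable_fibersD; last exact: measurable_fibers_rv.
  exact: (measurable_fibers_sum (Z := fun j : 'I_k.+1 => Z (inr (c, (j : nat))))
    (index_enum _) (fun j m => F_measurable (FZ (inr (c, (j : nat))) m))).
- by move=> x; rewrite mulr_ge0.
move=> b; have -> : (fun x => g x * h (\sum_(j < k.+1) Bern c j x + L c x)%N *
      (Z (inr (c, k)) x == b)%:R) =
    (fun x => (g x * (Z (inr (c, k)) x == b)%:R) *
      h (b + (\sum_(j < k) Bern c j x + L c x))%N).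
  apply/funext => x /=; rewrite big_ord_recr /= [RHS]mulrAC.
  have [<-|] := eqVneq; last by rewrite !mulr0.
  by rewrite [in RHS]addnA (addnC (Bern c k x : nat)).
have [_ gk] := indep_funM F_measurable gJ Jk (FZ (inr (c, k))) (fun m => ler0n R (m
  == b)).
apply: (IHk _ _ (fun m => h (b + m)%N) gk) => //.
- by move=> i J'i; split; [exact: J'J|move=> ik; rewrite ik in J'i].
- move=> j jk; have [? ?] := kJ j (ltnW jk); split => //; split => //= -[jkE].
  by rewrite jkE ltnn in jk.
Qed.

(** Hiding the indicator of a fiber in the factor at [p] keeps the product in the form that the
    induction hypothesis covers. *)
Let prod_fiber (A : {set 'I_n}) p k (h : 'I_n -> nat -> R) (m : 'I_n -> nat) :
  p \in A ->
  (\prod_(u in A) h u (m u)) * (m p == k)%:R =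
  \prod_(u in A) (h u (m u) * (if u == p then (m u == k)%:R else 1)).
Proof.
move=> pA; rewrite big_split /=; congr *%R.
by rewrite (bigD1 p)//= eqxx big1 ?mulr1// => u /andP[_ /negbTE ->].
Qed.

Let NE c x : c != r ->
  N c x = (\sum_(j < N (pa e r c) x) Bern c j x + L c x)%N.
Proof. by move=> cr; have [_ _ _ _ ->] := constr. Qed.

Let fiber_ge0 (h : 'I_n -> nat -> R) p k u m : (forall u m, 0 <= h u m) ->
  0 <= h u m * (if u == p then (m == k)%:R else 1).
Proof. by move=> h0; rewrite mulr_ge0//; case: ifP. Qed.

Let measurable_prod (A : {set 'I_n}) (h : 'I_n -> nat -> R) :
  measurable_fun setT (fun x => \prod_(u in A) h u (N u x)).
Proof.
by apply: measurable_bigprod => u; exact: (measurable_fun_fibers (h u) (mN u)).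
Qed.

(** The functions [h] are arbitrary so that the indicator of the parent's value can be included in
    them. Once this value is [k], the factor of the new vertex depends only on its innovation and
    its first [k] Bernoulli variables, all outside [A]. *)
Lemma indep_fun_closed (A : {set 'I_n}) : parent_closed e r A ->
  forall h : 'I_n -> nat -> R, (forall u m, 0 <= h u m) ->
  indep_fun P F (fun x => \prod_(u in A) h u (N u x)) (outside A).
Proof.
have [_ _ indep NrE _] := constr.
elim/(parent_closed_ind (r := r) tree_e) => [|{}A c clA cA cr pA IH] h h0.
  have [|_] := indep_funM (c := inl r) F_measurable (indep_fun1 F_measurable indep)
    _ (FZ (inl r)) (h0 r) => //.
  have -> : (fun x => \prod_(u in [set r]%SET) h u (N u x)) = (fun x => cst 1 x * h
    r (Z (inl r) x)).
    by apply/funext => x; rewrite big_set1 NrE mul1r.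
  apply: indep_fun_sub => -[u|[u j]] /=; rewrite finset.in_set1.
    by move=> ur; split => // -[ure]; rewrite ure eqxx in ur.
  by rewrite andbb => ur; split.
apply: (indep_fun_fibers F_measurable (mN (pa e r c))).
- exact: measurable_prod.
- by move=> x; apply: prodr_ge0.
move=> k; have -> : (fun x => (\prod_(u in (c |: A)%SET) h u (N u x)) * (N (pa e r
  c) x == k)%:R) =
    (fun x => (\prod_(u in A) (h u (N u x) * (if u == pa e r c then (N u x == k)%:R
      else 1)))
              * h c (\sum_(j < k) Bern c j x + L c x)%N).
  apply/funext => x; rewrite big_setU1//= -prod_fiber//.
  have [Nk|] := eqVneq; last by rewrite !mulr0 mul0r.
  by rewrite NE// Nk !mulr1 mulrC.
apply: (indep_fun_node (J := outside A)) => //.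
- by apply: (IH (fun u m => h u m * (if u == pa e r c then (m == k)%:R else 1))) =>
  u m; exact: fiber_ge0.
- by move=> [u|[u j]] /=; rewrite finset.in_setU1 negb_or -?andbA => /andP[_].
- by rewrite /outside /= finset.in_setU1 eqxx.
- by move=> j _; rewrite /outside /= finset.in_setU1 eqxx cA cr.
Qed.

(** Given its parent, the leaf integrates to a Poisson factor times one Bernoulli generating
    function per unit of the parent; the latter multiply the variable of the parent. *)
Let integral_leaf (A : {set 'I_n}) c (t : 'I_n -> R) (s : R) :
  parent_closed e r A -> c \notin A -> c != r -> pa e r c \in A ->
  (forall u, 0 <= t u) -> 0 <= s ->
  (\int[P]_x ((\prod_(u in A) t u ^+ N u x) * s ^+ N c x)%:E =
   \int[P]_x (\prod_(u in A)
     (t u * (if u == pa e r c then 1 - theta c + theta c * s else 1)) ^+ N u x)%:E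
   * (expR (rate c * (s - 1)))%:E)%E.
Proof.
move=> clA cA cr pA t0 s0; have [dL dB _ _ _] := constr.
set p := pa e r c; set q := 1 - theta c + _.
have th01 := thinning_prob_itv tree_e adm cr.
have /andP[th0 th1] := th01.
have q0 : 0 <= q by rewrite addr_ge0 ?subr_ge0 ?(mulr_ge0 th0).
have t'0 u : 0 <= t u * (if u == p then q else 1) by rewrite mulr_ge0//; case: ifP.
have qE x : \prod_(u in A) (t u * (if u == p then q else 1)) ^+ N u x =
            (\prod_(u in A) t u ^+ N u x) * q ^+ N p x.
  under eq_bigr do rewrite exprMn; rewrite big_split /=; congr *%R.
  by rewrite (bigD1 p)//= eqxx big1 ?mulr1// => u /andP[_ /negbTE ->]; rewrite expr1n.
have mAt := @measurable_prod A (fun u m => t u ^+ m).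
have At0 x : 0 <= \prod_(u in A) t u ^+ N u x.
  by apply: prodr_ge0 => u _; exact: exprn_ge0.
rewrite -ge0_integralZr//; first last.
- by move=> x _; rewrite lee_fin; apply: prodr_ge0 => u _; exact: exprn_ge0.
- apply/measurable_EFinP.
  exact: (@measurable_prod A (fun u m => (t u * (if u == p then q else 1)) ^+ m)).
under [RHS]eq_integral do rewrite qE -EFinM.
apply: (eq_integral_fibers (mN p)).
- apply/measurable_EFinP; apply: measurable_funM => //.
  exact: (measurable_fun_fibers (fun m => s ^+ m) (mN c)).
- apply/measurable_EFinP; apply: measurable_funM => //; apply: measurable_funM => //.
  exact: (measurable_fun_fibers (fun m => q ^+ m) (mN p)).
- by move=> x; rewrite lee_fin mulr_ge0// exprn_ge0.
- by move=> x; rewrite lee_fin !mulr_ge0// ?exprn_ge0// expR_ge0.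
move=> k; rewrite -[N p @^-1` _]setTI !integral_fiber_eq.
pose g x := \prod_(u in A) (t u ^+ N u x * (if u == p then (N u x == k)%:R else 1)).
have gE x : g x = (\prod_(u in A) t u ^+ N u x) * (N p x == k)%:R.
  by rewrite /g -(@prod_fiber A p k (fun u m => t u ^+ m) (fun u => N u x)).
have tm0 u m : 0 <= t u ^+ m by exact: exprn_ge0.
have gA : indep_fun P F g (outside A).
  apply: (indep_fun_closed clA
    (h := fun u m => t u ^+ m * (if u == p then (m == k)%:R else 1))) => u m.
  exact: (fiber_ge0 (h := fun u m => t u ^+ m)).
(* On the event [N p x == k], the value of [N c] is the sum of exactly these variables: the
   innovation and [k] Bernoulli variables. *)
pose ks : seq ('I_n + 'I_n * nat) := inl c :: [seq inr (c, j) | j <- iota 0 k].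
transitivity (\int[P]_x (g x * \prod_(i <- ks) s ^+ (Z i x))%:E)%E.
  apply: eq_integral => x _; rewrite gE big_cons big_map /= mulrAC.
  have [Nk|] := eqVneq; last by rewrite !(mulr0, mul0r).
  rewrite !mulr1 NE// exprD -/p Nk; congr ((_ * _)%:E); rewrite mulrC; congr *%R.
  rewrite -(big_mkord xpredT (fun j => Bern c j x : nat)) /index_iota subn0.
  by rewrite -expr_sum.
rewrite (integral_indep_prod (K := ('I_n + 'I_n * nat)%type) F_measurable (c := id)
  (Z := Z) (h := fun _ m => s ^+ m) gA)//; first last.
- move=> i m; exact: exprn_ge0.
- by move=> i; rewrite in_cons => /predU1P[->//|/mapP[j _ ->]] /=; rewrite cA.
- rewrite map_id /= map_inj_uniq ?iota_uniq ?andbT//; last by move=> ? ? [].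
  by apply/mapP => -[].
transitivity ((\int[P]_x (g x)%:E) * (q ^+ k * expR (rate c * (s - 1)))%:E)%E.
  congr (_ * _)%E; rewrite big_cons big_map /= (poisson_pgf (dL c))//;
    last exact: innovation_rate_ge0.
  rewrite (eq_bigr (fun=> q%:E)); last by move=> j _;
    rewrite (bernoulli_pgf (dB c j cr)).
  rewrite EFinM muleC; congr (_ * _)%E; rewrite prodEFin; congr _%:E.
  by rewrite big_const_seq count_predT size_iota -Monoid.iteropE.
rewrite -ge0_integralZr//; first last.
- by rewrite lee_fin mulr_ge0// ?exprn_ge0// expR_ge0.
- by move=> x _; rewrite lee_fin; case: gA.
- by apply/measurable_EFinP; case: gA.
apply: eq_integral => x _; rewrite -EFinM gE; congr _%:E.
by have [->|] := eqVneq; [ring|rewrite !(mulr0, mul0r)].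
Qed.

Lemma rooted_pgf (t : 'I_n -> R) : (forall u, 0 <= t u <= 1) ->
  (\int[P]_x (\prod_u t u ^+ N u x)%:E =
   (expR (log_pgf e lambda alpha r t))%:E)%E.
Proof.
move=> t01; have [dL _ _ NrE _] := constr.
pose eta' u := eta e r u t theta.
have eta01 u : 0 <= eta' u <= 1 by exact: eta_itv.
pose w j := 1 - theta j + theta j * eta' j.
have w0 j : j != r -> 0 <= w j.
  move=> jr; have /andP[th0 th1] := thinning_prob_itv tree_e adm jr.
  by have /andP[e0 _] := eta01 j; rewrite addr_ge0 ?subr_ge0 ?(mulr_ge0 th0).
(* The variable of [u] after its children outside [A] have been peeled off: [t u] itself when [A] is
   everything, [eta' u] when no child is left in [A]. *)
pose tau (A : {set 'I_n}) u := t u * \prod_(j in ch e r u | j \notin A) w j.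
have tau0 A u : 0 <= tau A u.
  rewrite mulr_ge0//; first by have /andP[] := t01 u.
  by apply: prodr_ge0 => j; rewrite mem_ch => /andP[/andP[jr _] _]; exact: w0.
suff H A : parent_closed e r A ->
    (\int[P]_x (\prod_(u in A) tau A u ^+ N u x)%:E =
     (expR (\sum_(u in A) rate u * (eta' u - 1)))%:E)%E.
  have := H _ (parent_closedT e r); rewrite /log_pgf.
  rewrite [in X in _ = X -> _](eq_bigl xpredT); last by move=> u;
    rewrite finset.in_setT.
  move=> <-; apply: eq_integral => x _; congr _%:E.
  rewrite [RHS](eq_bigl xpredT); last by move=> u; rewrite finset.in_setT.
  by apply: eq_bigr => u _; rewrite /tau big1 ?mulr1// => j;
    rewrite finset.in_setT andbF.
elim/(parent_closed_ind (r := r) tree_e) => [|{}A c clA cA cr pA IH].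
  under eq_integral do rewrite big_set1 NrE.
  have -> : tau [set r]%SET r = eta' r.
    rewrite /tau /eta' etaE//; congr *%R; apply: eq_bigl => j.
    by rewrite !mem_ch finset.in_set1; case: eqP => //= _; rewrite andbT.
  rewrite big_set1 (poisson_pgf (dL r))//; first exact: innovation_rate_ge0.
  by case/andP: (eta01 r).
have pcc : pa e r c != c by apply: contraNneq cA => <-.
have chA j : j \in ch e r c -> j \notin A.
  rewrite mem_ch => /andP[jr /eqP pj]; apply/negP => jA.
  by have [_ /(_ j jA jr)] := clA; rewrite pj (negbTE cA).
have tauc : tau (c |: A)%SET c = eta' c.
  rewrite /tau /eta' etaE//; congr *%R; apply: eq_bigl => j.
  rewrite finset.in_setU1 negb_or; case jc: (j \in ch e r c) => //=.
  rewrite chA// andbT; apply: contraTneq jc => ->; rewrite mem_ch.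
  by rewrite (negbTE pcc) andbF.
have tauA u : u \in A ->
    tau (c |: A)%SET u * (if u == pa e r c then w c else 1) = tau A u.
  move=> uA; rewrite /tau -mulrA; congr *%R.
  have [->|up] := eqVneq u (pa e r c); last first.
    rewrite mulr1; apply: eq_bigl => j; rewrite finset.in_setU1 negb_or mem_ch.
    case: (j =P c) => [->|//]; by rewrite (eq_sym _ u) (negbTE up) !andbF.
  rewrite [RHS](bigD1 c) ?mem_ch ?cr ?eqxx//= mulrC; congr *%R.
  by apply: eq_bigl => j; rewrite finset.in_setU1 negb_or -andbA (andbC (j \notin A)).
under eq_integral do rewrite big_setU1//= mulrC tauc.
rewrite integral_leaf//; last by case/andP: (eta01 c).
under eq_integral => x _.
  under eq_bigr => u uA do rewrite tauA//.
  over.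
by rewrite IH -EFinM -expRD big_setU1//= [in RHS]addrC.
Qed.

End RootedPgf.

Section VectorEvents.
Context d (T : measurableType d) (R : realType) (P : probability T R) (n : nat).
Context (N : 'I_n -> {RV P >-> nat}).

Let events := g_sigma_preimage (fun u => N u : T -> nat).

Lemma g_sigma_preimage_measurable A : events A -> measurable A.
Proof.
apply: smallest_sub; first exact: sigma_algebra_measurable.
move=> B; rewrite -bigcup_seq => -[u _ [C mC <-]]; exact: measurable_funP.
Qed.

Lemma g_sigma_preimage_vector (a : {ffun 'I_n -> nat}) :
  events ((fun w => [ffun u => N u w]) @^-1` [set a]).
Proof.
have -> : (fun w => [ffun u => N u w]) @^-1` [set a] =
    \big[setI/setT]_(u <- index_enum 'I_n) N u @^-1` [set a u].
  rewrite -bigcap_seq; apply/seteqP; split=> w /= => [<- i _ /=|H];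
    first by rewrite ffunE.
  by apply/ffunP => i; rewrite ffunE; apply: H; rewrite /= mem_index_enum.
rewrite -[events _]/(@measurable _ (g_sigma_algebraType _) _).
apply: bigsetI_measurable => u _; apply: sub_sigma_algebra.
rewrite -bigcup_seq; exists u; first by rewrite /= mem_index_enum.
by exists [set a u] => //; rewrite setTI.
Qed.

End VectorEvents.

(** * Size bias of the field at one vertex *)

Section SizeBias.
Context (n : nat) (R : realType) (e : rel 'I_n).
Context (lambda : 'I_n -> R) (alpha : 'I_n -> 'I_n -> R).
Hypotheses (tree_e : is_tree e) (adm : admissible e lambda alpha).
Context d (T : measurableType d) (P : probability T R) (N : 'I_n -> {RV P >-> nat}).
Hypothesis N_MPMRF : MPMRF e lambda alpha N.

Let mN u : measurable_fibers (N u).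
Proof. exact: measurable_fibers_rv. Qed.

Lemma MPMRF_pgf v (t : 'I_n -> R) : (forall u, 0 <= t u <= 1) ->
  (\int[P]_x (\prod_u t u ^+ N u x)%:E =
   (expR (log_pgf e lambda alpha v t))%:E)%E.
Proof.
move=> t01; have [r [d' [T' [P' [L [Bern [N' [constr NN']]]]]]]] := N_MPMRF.
rewrite (log_pgf_root tree_e adm r) -(rooted_pgf tree_e adm constr t01).
(* Vectors are read as finite functions, a countable type, so that [eq_integral_law] transports the
   integral from the space of the construction. *)
pose h (m : {ffun 'I_n -> nat}) := \prod_u t u ^+ m u.
have mN' u : measurable_fibers (N' u) by exact: measurable_fibers_rv.
transitivity (\int[P]_x (h [ffun u => N u x])%:E)%E.
  by apply: eq_integral => x _; congr _%:E; apply: eq_bigr => u _; rewrite ffunE.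
transitivity (\int[P']_x (h [ffun u => N' u x])%:E)%E; last first.
  by apply: eq_integral => x _; congr _%:E; apply: eq_bigr => u _; rewrite ffunE.
apply: (eq_integral_law (Z := fun x => [ffun u => N u x]) (Z' := fun x => [ffun u
  => N' u x])).
- exact: measurable_fibers_vector.
- exact: measurable_fibers_vector.
- by move=> c; exact: (NN' [set m | [ffun u => m u] = c]).
- by move=> c; apply: prodr_ge0 => u _; rewrite exprn_ge0//; case/andP: (t01 u).
Qed.

(* The law of N does not depend on the root; rooted at v, its generating
   function is the exponential of an affine function of the v-th variable, whose
   expansion gives the law of N v weighted by the other variables. *)
Lemma MPMRF_size_bias v (t : 'I_n -> R) : (forall u, 0 <= t u <= 1) ->
  (\int[P]_x ((N v x)%:R * t v ^+ (N v x).-1 * \prod_(u | u != v) t u ^+ N u x)%:E =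
   (lambda v * eta e v v [eta t with v |-> 1] (thinning_prob e lambda alpha v))%:E *
   \int[P]_x (\prod_u t u ^+ N u x)%:E)%E.
Proof.
move=> t01; set b := lambda v * _.
have upd01 s : 0 <= s <= 1 -> forall u, 0 <= [eta t with v |-> s] u <= 1.
  by move=> s01 u /=; case: ifP.
have b0 : 0 <= b.
  have [l0 _ _] := adm; rewrite mulr_ge0 ?(ltW (l0 v))//.
  have one01 : 0 <= (1 : R) <= 1 by rewrite ler01 lexx.
  by have /andP[] := eta_itv tree_e adm v v (upd01 1 one01).
pose W x := \prod_(u | u != v) t u ^+ N u x.
have W0 x : 0 <= W x.
  by apply: prodr_ge0 => u _; rewrite exprn_ge0//; case/andP: (t01 u).
have mW : measurable_fun setT W.
  apply: measurable_bigprod => u.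
  exact: (measurable_fun_fibers (fun k => t u ^+ k) (mN u)).
pose a := log_pgf e lambda alpha v [eta t with v |-> 0].
pose p k := (\int[P]_(x in N v @^-1` [set k]) (W x)%:E)%E.
have pgfW s : 0 <= s <= 1 -> (\int[P]_x (W x * s ^+ N v x)%:E = (expR (a + b *
  s))%:E)%E.
  move=> s01; rewrite -log_pgf_affine// -(MPMRF_pgf _ (upd01 s s01)).
  apply: eq_integral => x _; congr _%:E; rewrite [RHS](bigD1 v)//= eqxx mulrC.
  by congr *%R; apply: eq_bigr => u /negbTE ->.
have p0 k : (0 <= p k)%E by apply: integral_ge0 => x _; rewrite lee_fin.
have tv0 : 0 <= t v by case/andP: (t01 v).
(* The coefficients of exp (a + b s) as a power series in s. *)
pose q k := (expR a * (b ^+ k / k`!%:R))%:E.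
have q0 k : (0 <= q k)%E.
  by rewrite lee_fin mulr_ge0 ?expR_ge0// divr_ge0// exprn_ge0.
have pE : p =1 q.
  apply: pgf_inj => //.
    have := pgfW 1; rewrite ler01 lexx => /(_ isT).
    rewrite (integral_expr_fibers P (mN v))// => H.
    rewrite (eq_eseriesr (g := fun k => p k * (1 ^+ k)%:E)%E); last first.
      by move=> k _; rewrite expr1n mule1.
    by rewrite H ltry.
  move=> s /andP[s0 s1]; rewrite -integral_expr_fibers//; last exact: ltW.
  rewrite pgfW ?(ltW s0)// expRD EFinM (expR_nneseries (b * s)) -nneseriesZl;
    last first.
    by move=> k _; rewrite lee_fin divr_ge0// exprn_ge0// mulr_ge0// ltW.
  by apply: eq_eseriesr => k _; rewrite -!EFinM exprMn; congr _%:E;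
    rewrite -!mulrA; congr *%R; congr *%R; rewrite mulrC.
transitivity (\sum_(k <oo) (k%:R * t v ^+ k.-1)%:E * p k)%E.
  rewrite (ge0_integral_fibers (mN v))//; first last.
  - by move=> x; rewrite lee_fin; apply: mulr_ge0; [rewrite mulr_ge0//
    exprn_ge0|exact: W0].
  - apply/measurable_EFinP; apply: measurable_funM => //.
    exact: (measurable_fun_fibers (fun k => k%:R * t v ^+ k.-1) (mN v)).
  apply: eq_eseriesr => k _; under eq_integral do rewrite mulrC.
  rewrite (integral_fiber_cst (h := fun k => k%:R * t v ^+ k.-1))// ?setTI//.
  by rewrite mulr_ge0// exprn_ge0.
(* The term k = 0, where [k.-1] is truncated, vanishes. The others are shifted by one, and (k + 1)
   q_(k+1) = b q_k. *)
rewrite nneseries_recl//; last by move=> k _; rewrite mule_ge0// lee_fin mulr_ge0//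
  exprn_ge0.
rewrite mul0r mul0e add0e -(nneseries_addn 1); last first.
  by move=> k; rewrite mule_ge0// lee_fin mulr_ge0// exprn_ge0.
transitivity (\sum_(k <oo) b%:E * (p k * (t v ^+ k)%:E))%E.
  apply: eq_eseriesr => k _; rewrite addn1 /= !pE /q -!EFinM; congr _%:E.
  rewrite factS natrM exprS invfM.
  have k1 : k.+1%:R != 0 :> R by rewrite pnatr_eq0.
  move: (t v ^+ k) (expR a) (b ^+ k) (k`!%:R^-1 : R) (k.+1%:R : R) k1 => x y z f m m0.
  by field.
rewrite nneseriesZl; last by move=> k _; rewrite mule_ge0// lee_fin exprn_ge0.
congr (_ * _)%E; rewrite -integral_expr_fibers//; apply: eq_integral => x _.
by rewrite [in RHS](bigD1 v)//= mulrC.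
Qed.

End SizeBias.

(** * Compound sums *)

Section CompoundIntegral.
Context d (T : measurableType d) (R : realType) (P : probability T R).
Context (I : choiceType) (F : I -> set (set T)) (n : nat) (D : set I) (c0 : I).
Context (M : 'I_n -> {RV P >-> nat}) (c : 'I_n * nat -> I) (Z : 'I_n * nat -> T -> nat).
Hypothesis F_measurable : forall i A, F i A -> measurable A.
Hypothesis indep : mutual_independence P D F.
Hypothesis Dc0 : D c0.
Hypothesis FM : forall a : {ffun 'I_n -> nat},
  F c0 ((fun w => [ffun u => M u w]) @^-1` [set a]).
Hypothesis c_inj : injective c.
Hypothesis cc0 : forall k, c k != c0.
Hypothesis Dc : forall k, D (c k).
Hypothesis FZ : forall k m, F (c k) (Z k @^-1` [set m]).

Let mM : measurable_fibers (fun w => [ffun u => M u w]).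
Proof. by move=> a; exact: F_measurable (FM a). Qed.

Let integral_vector_fiber (f : T -> R) (h : ('I_n -> nat) -> R) (a : {ffun 'I_n ->
  nat}) :
  0 <= h a ->
  (\int[P]_(x in (fun w => [ffun u => M u w]) @^-1` [set a]) (f x)%:E =
   P ((fun w => [ffun u => M u w]) @^-1` [set a]) * (h a)%:E)%E ->
  (\int[P]_(x in (fun w => [ffun u => M u w]) @^-1` [set a]) (f x)%:E =
   \int[P]_(x in (fun w => [ffun u => M u w]) @^-1` [set a]) (h (fun u => M u x))%:E)%E.
Proof.
move=> h0 ->; transitivity (\int[P]_(x in (fun w => [ffun u => M u w]) @^-1` [set
  a]) cst (h a)%:E x)%E.
  by rewrite muleC integral_cst.
apply: eq_integral => x /set_mem /= <-; congr (h _)%:E.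
by apply/funext => u; rewrite ffunE.
Qed.

Let measurable_vector (h : ('I_n -> nat) -> R) :
  measurable_fun setT (fun x => h (fun u => M u x)).
Proof.
rewrite (_ : (fun x => _) = (fun m : {ffun 'I_n -> nat} => h m) \o (fun x => [ffun
  u => M u x])).
  exact: (measurable_fun_fibers _ mM).
by apply/funext => x /=; congr h; apply/funext => u; rewrite ffunE.
Qed.

(** Serves for both S and K: the terms attached to one vertex only have to share their generating
    function at the given [t]. *)
Lemma compound_pgf (t : R) (phi : 'I_n -> R) : 0 <= t -> (forall u, 0 <= phi u) ->
  (forall u j, \int[P]_x (t ^+ Z (u, j) x)%:E = (phi u)%:E)%E ->
  measurable_fibers (fun x => \sum_u \sum_(j < M u x) Z (u, (j : nat)) x)%N ->
  (\int[P]_x (t ^+ (\sum_u \sum_(j < M u x) Z (u, (j : nat)) x))%:E =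
   \int[P]_x (\prod_u phi u ^+ M u x)%:E)%E.
Proof.
move=> t0 phi0 Zphi mS; apply: (eq_integral_fibers mM).
- by apply/measurable_EFinP; exact: (measurable_fun_fibers (fun m => t ^+ m) mS).
- by apply/measurable_EFinP; exact: (measurable_vector (fun m => \prod_u phi u ^+ m u)).
- by move=> x; rewrite lee_fin exprn_ge0.
- by move=> x; rewrite lee_fin prodr_ge0// => u _; rewrite exprn_ge0.
move=> a; apply: (integral_vector_fiber (h := fun m => \prod_u phi u ^+ m u)).
  by rewrite prodr_ge0// => u _; rewrite exprn_ge0.
transitivity (P ((fun w => [ffun u => M u w]) @^-1` [set a]) *
    \prod_u \prod_(j < a u) \int[P]_x (t ^+ Z (u, (j : nat)) x)%:E)%E.
  rewrite -(integral_compound_prod F_measurable (h := fun _ m => t ^+ m) a indep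
    Dc0 (FM a) c_inj cc0 Dc FZ)//; last by move=> *; rewrite exprn_ge0.
  apply: eq_integral => x /set_mem /= Mxa; congr _%:E.
  rewrite expr_sum; apply: eq_bigr => u _; rewrite expr_sum.
  by have -> : M u x = a u by rewrite -Mxa ffunE.
congr (_ * _)%E; rewrite -prodEFin; apply: eq_bigr => u _.
rewrite (eq_bigr (fun=> (phi u)%:E)); last by move=> j _; rewrite Zphi.
by rewrite prodEFin prodr_const card_ord.
Qed.

(** With the counts fixed, linearity singles out one term of the sum at [v]. It contributes [psi]
    and each other term its [phi], so the M_v choices give M_v psi phi_v^(M_v - 1) times the factors
    of the other vertices. *)
Lemma compound_size_bias (t : R) (phi : 'I_n -> R) (psi : R) (v : 'I_n) :
  0 <= t -> (forall u, 0 <= phi u) -> 0 <= psi ->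
  (forall u j, \int[P]_x (t ^+ Z (u, j) x)%:E = (phi u)%:E)%E ->
  (forall j, \int[P]_x ((Z (v, j) x)%:R * t ^+ Z (v, j) x)%:E = psi%:E)%E ->
  measurable_fibers (fun x => \sum_u \sum_(j < M u x) Z (u, (j : nat)) x)%N ->
  measurable_fun setT (fun x => (\sum_(j < M v x) Z (v, (j : nat)) x)%:R : R) ->
  (\int[P]_x ((\sum_(j < M v x) Z (v, (j : nat)) x)%:R *
      t ^+ (\sum_u \sum_(j < M u x) Z (u, (j : nat)) x))%:E =
   psi%:E * \int[P]_x ((M v x)%:R * phi v ^+ (M v x).-1
                       * \prod_(u | u != v) phi u ^+ M u x)%:E)%E.
Proof.
move=> t0 phi0 psi0 Zphi Zpsi mS mX.
pose h (m : 'I_n -> nat) := psi * ((m v)%:R * phi v ^+ (m v).-1 * \prod_(u | u !=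
  v) phi u ^+ m u).
have h'0 m : 0 <= (m v)%:R * phi v ^+ (m v).-1 * \prod_(u | u != v) phi u ^+ m u.
  by rewrite !mulr_ge0// ?exprn_ge0// prodr_ge0// => u _; rewrite exprn_ge0.
have h0 m : 0 <= h m by rewrite mulr_ge0.
rewrite -ge0_integralZl_EFin//; first last.
- apply/measurable_EFinP.
  exact: (measurable_vector (fun m => (m v)%:R * phi v ^+ (m v).-1 * \prod_(u | u
    != v) phi u ^+ m u)).
- by move=> x _; rewrite lee_fin; exact: (h'0 (fun u => M u x)).
have mZ k : measurable_fibers (Z k) by move=> m; exact: F_measurable (FZ k m).
apply: (eq_integral_fibers mM).
- apply/measurable_EFinP; apply: measurable_funM => //.
  exact: (measurable_fun_fibers (fun m => t ^+ m) mS).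
- by apply/measurable_EFinP; exact: (measurable_vector h).
- by move=> x; rewrite lee_fin mulr_ge0// exprn_ge0.
- by move=> x; rewrite lee_fin; exact: (h0 (fun u => M u x)).
move=> a; apply: (integral_vector_fiber (h := h)) => //.
(* The extra factor m sits at the singled-out term (v, i) only, which keeps the integrand a product
   over independent variables. *)
pose g (i : nat) (k : 'I_n * nat) (m : nat) : R := (if k == (v, i) then m%:R else
  1) * t ^+ m.
have g0 i k m : 0 <= g i k m by rewrite mulr_ge0 ?exprn_ge0//; case: ifP.
transitivity (\int[P]_(x in (fun w => [ffun u => M u w]) @^-1` [set a])
   (\sum_(i <- index_enum 'I_(a v)) (\prod_u \prod_(j < a u) g i (u, (j : nat)) (Z
     (u, (j : nat)) x))%:E))%E.
  apply: eq_integral => x /set_mem /= Mxa.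
  have ME u : M u x = a u by rewrite -Mxa ffunE.
  rewrite sumEFin; congr _%:E; rewrite ME natr_sum mulr_suml; apply: eq_bigr => i _.
  under [RHS]eq_bigr do rewrite big_split /=.
  rewrite big_split /=; congr *%R; last first.
    by rewrite expr_sum; apply: eq_bigr => u _; rewrite expr_sum ME.
  rewrite (bigD1 v)//= (bigD1 i)//= eqxx big1 ?mulr1; last first.
    by move=> j ji; rewrite xpair_eqE eqxx /= (negbTE (ji : j != i :> nat)).
  rewrite big1 ?mulr1// => u uv; rewrite big1// => j _.
  by rewrite xpair_eqE (negbTE uv).
rewrite ge0_integral_sum//; first last.
- by move=> i x _; rewrite lee_fin; apply: prodr_ge0 => u _; apply: prodr_ge0 => j _.
- move=> i; apply/measurable_EFinP; apply: measurable_funTS.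
  apply: measurable_bigprod => u; apply: measurable_bigprod => j.
  exact: (measurable_fun_fibers (g i (u, (j : nat))) (mZ _)).
rewrite (eq_bigr (fun=> P ((fun w => [ffun u => M u w]) @^-1` [set a]) *
   (psi * (phi v ^+ (a v).-1 * \prod_(u | u != v) phi u ^+ a u))%:E)%E); last first.
  move=> i _.
  rewrite (integral_compound_prod F_measurable (h := g i) a indep Dc0 (FM a) c_inj
    cc0 Dc FZ)//.
  congr (_ * _)%E; rewrite (bigD1 v)//= (bigD1 i)//= /g eqxx Zpsi.
  rewrite [X in (_ * X * _)%E](eq_bigr (fun=> (phi v)%:E)); last first.
    move=> j ji; rewrite -(Zphi v j); apply: eq_integral => x _.
    by rewrite xpair_eqE eqxx /= (negbTE (ji : j != i :> nat)) mul1r.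
  rewrite [X in (_ * X)%E](eq_bigr (fun u => (phi u ^+ a u)%:E)); last first.
    move=> u uv; rewrite (eq_bigr (fun=> (phi u)%:E)) ?prodEFin ?prodr_const
      ?card_ord//.
    move=> j _; rewrite -(Zphi u j); apply: eq_integral => x _.
    by rewrite xpair_eqE (negbTE uv) mul1r.
  rewrite !prodEFin -!EFinM prodr_const cardC1 card_ord; congr _%:E.
  by rewrite mulrA.
rewrite -(fineK (fin_num_measure P _ (mM a))) -!EFinM sumEFin sumr_const card_ord.
by rewrite -mulr_natr /h; congr _%:E; ring.
Qed.

End CompoundIntegral.

(** * Generating functions of claims and of their size-biased copies *)

Section NatPgf.
Context d (T : measurableType d) (R : realType) (P : probability T R).

Lemma pgf_itv (Z : T -> nat) (t : R) : measurable_fibers Z -> 0 <= t <= 1 ->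
  exists2 p, (\int[P]_x (t ^+ Z x)%:E)%E = p%:E & 0 <= p <= 1.
Proof.
move=> mZ /andP[t0 t1].
have int0 : (0 <= \int[P]_x (t ^+ Z x)%:E)%E.
  by apply: integral_ge0 => x _; rewrite lee_fin exprn_ge0.
have int1 : (\int[P]_x (t ^+ Z x)%:E <= 1)%E.
  apply: (@le_trans _ _ (\int[P]_x (cst 1 x)%:E)%E).
    apply: ge0_le_integral => //.
    - by move=> x _; rewrite lee_fin exprn_ge0.
    - by apply/measurable_EFinP; exact: (measurable_fun_fibers (fun m => t ^+ m) mZ).
    - by apply/measurable_EFinP; exact: measurable_cst.
    - by move=> x _; rewrite lee_fin exprn_ile1.
  rewrite -[X in (X <= _)%E]/(\int[P]_x cst 1 x)%E integral_cst// mul1e.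
  exact: probability_le1.
have fin : (\int[P]_x (t ^+ Z x)%:E)%E \is a fin_num.
  by rewrite ge0_fin_numE// (le_lt_trans int1) ?ltry.
exists (fine (\int[P]_x (t ^+ Z x)%:E)%E); first by rewrite fineK.
by rewrite fine_ge0//= -lee_fin fineK.
Qed.

Lemma copy_integral (B' B : {RV P >-> nat}) (h : nat -> R) :
  copy B' B -> (forall k, 0 <= h k) ->
  (\int[P]_x (h (B' x))%:E = \int[P]_x (h (B x))%:E)%E.
Proof.
move=> B'B h0; apply: eq_integral_law => //; try exact: measurable_fibers_rv.
by move=> k; exact: B'B.
Qed.

Lemma mean_fineK (B : {RV P >-> nat}) : (0 < mean B < +oo)%E ->
  exists2 m, mean B = m%:E & 0 < m.
Proof.
move=> /andP[m0 moo]; exists (fine (mean B)).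
  by rewrite fineK// ge0_fin_numE// ltW.
by rewrite fine_gt0// m0.
Qed.

Lemma size_biased_pgf (B B' : {RV P >-> nat}) (t : R) :
  (0 < mean B < +oo)%E -> size_biased B' B -> 0 <= t ->
  (\int[P]_x ((B x)%:R * t ^+ B x)%:E = mean B * \int[P]_x (t ^+ B' x)%:E)%E.
Proof.
move=> mB B'B t0; have [m mE m0] := mean_fineK mB; rewrite mE.
have fB : measurable_fibers B by exact: measurable_fibers_rv.
have fB' : measurable_fibers B' by exact: measurable_fibers_rv.
rewrite (ge0_integral_comp_fibers (h := fun k => k%:R * t ^+ k) fB); last first.
  by move=> k; rewrite mulr_ge0// exprn_ge0.
rewrite (ge0_integral_comp_fibers (h := fun k => t ^+ k) fB'); last first.
  by move=> k; rewrite exprn_ge0.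
rewrite -nneseriesZl; last by move=> k _; rewrite mule_ge0// lee_fin exprn_ge0.
apply: eq_eseriesr => k _; rewrite B'B mE /= !muleA -!EFinM; congr (_%:E * _)%E.
by field; rewrite gt_eqF.
Qed.

End NatPgf.

(** * The contribution of one vertex under Euler's rule *)

Section EulerContribution.
Context (R : realType) (n : nat) (e : rel 'I_n).
Context (lambda : 'I_n -> R) (alpha : 'I_n -> 'I_n -> R).
Hypotheses (tree_e : is_tree e) (adm : admissible e lambda alpha).
Context (d : measure_display) (T : measurableType d) (P : probability T R).
Context (N : 'I_n -> {RV P >-> nat}) (N_MPMRF : MPMRF e lambda alpha N).
Context (B : 'I_n -> {RV P >-> nat}) (Bs : 'I_n -> nat -> {RV P >-> nat}).
Hypothesis B_mean : forall v, (0 < mean (B v) < +oo)%E.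
Hypothesis Bs_copy : forall v j, copy (Bs v j) (B v).
Hypothesis Bs_indep : claims_independent N Bs.
Context (X : 'I_n -> {RV P >-> R}) (S : {RV P >-> R}).
Hypothesis XE : forall v w, X v w = compound (N v) (Bs v) w.
Hypothesis SE : forall w, S w = \sum_v X v w.
Context (v : 'I_n).
Context (G : 'I_n -> {RV P >-> nat}) (Bstar : nat -> {RV P >-> nat}).
Context (Bprime : 'I_n -> nat -> {RV P >-> nat}) (K : {RV P >-> R}).
Hypothesis KE : K_construction e lambda alpha B v G Bstar Bprime K.
Hypothesis K_indep : independent_rv P K S.

Let claim (k : 'I_n * nat) : T -> nat := Bs k.1 k.2.
(** A single family merging [Bstar] and [Bprime], so that K is a compound sum of the same shape as S
    with [G] in place of [N]. *)
Let kterm (k : 'I_n * nat) : T -> nat :=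
  if k.1 == v then Bstar k.2 else Bprime k.1 k.2.

Let Snat (x : T) : nat := (\sum_u \sum_(j < N u x) claim (u, (j : nat)) x)%N.
Let Knat (x : T) : nat := (\sum_u \sum_(j < G u x) kterm (u, (j : nat)) x)%N.

Let SnatE x : S x = (Snat x)%:R.
Proof.
rewrite SE /Snat natr_sum; apply: eq_bigr => u _.
by rewrite XE /compound natr_sum.
Qed.

Let KnatE x : K x = (Knat x)%:R.
Proof.
have [_ _ _ _ ->] := KE; rewrite /Knat [in RHS](bigD1 v)//= natrD; congr +%R.
  by rewrite /compound natr_sum; apply: eq_bigr => j _; rewrite /kterm eqxx.
rewrite natr_sum; apply: eq_bigr => u uv.
by rewrite /compound natr_sum; apply: eq_bigr => j _; rewrite /kterm /= (negbTE uv).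
Qed.

Let fiber_natr (Y : {RV P >-> R}) (y : T -> nat) k :
  (forall x, Y x = (y x)%:R) -> y @^-1` [set k] = Y @^-1` [set k%:R].
Proof.
move=> Yy; apply/seteqP; split=> x /=; rewrite Yy; first by move=> ->.
by move/eqP; rewrite eqr_nat => /eqP.
Qed.

Let measurable_fibers_natr (Y : {RV P >-> R}) (y : T -> nat) :
  (forall x, Y x = (y x)%:R) -> measurable_fibers y.
Proof.
by move=> Yy k; rewrite (fiber_natr k Yy) -[X in measurable X]setTI;
  exact: measurable_funP.
Qed.

Let mSnat : measurable_fibers Snat := measurable_fibers_natr SnatE.
Let mKnat : measurable_fibers Knat := measurable_fibers_natr KnatE.

Let Fclaim (k : unit + 'I_n * nat) : set (set T) :=
  match k with
  | inl _ => g_sigma_preimage (fun u => N u : T -> nat)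
  | inr (u, j) => sigma_rv (Bs u j)
  end.

Let Fclaim_measurable k A : Fclaim k A -> measurable A.
Proof.
case: k => [a|[u j]]; [exact: g_sigma_preimage_measurable|exact: sigma_rv_measurable].
Qed.

Let Fterm (k : unit + nat + 'I_n * nat) : set (set T) :=
  match k with
  | inl (inl _) => g_sigma_preimage (fun u => G u : T -> nat)
  | inl (inr i) => sigma_rv (Bstar i)
  | inr (j, i) => sigma_rv (Bprime j i)
  end.

Let Fterm_measurable k A : Fterm k A -> measurable A.
Proof.
case: k => [[a|i]|[j i]]; [exact: g_sigma_preimage_measurable|exact:
  sigma_rv_measurable|exact: sigma_rv_measurable].
Qed.

Let term_index (k : 'I_n * nat) : unit + nat + 'I_n * nat :=
  if k.1 == v then inl (inr k.2) else inr k.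

Let term_index_inj : injective term_index.
Proof.
move=> [u i] [w j]; rewrite /term_index /=.
by case: eqP => [->|_]; case: eqP => [->|_] // => -[->] //; move=> ->.
Qed.

Let Fterm_kterm k m : Fterm (term_index k) (kterm k @^-1` [set m]).
Proof.
by rewrite /term_index /kterm; case: k => u j /=; case: eqP => _ /=;
  exact: sigma_rv_preimage.
Qed.

Let KSnat_pgf (t : R) : 0 <= t ->
  (\int[P]_x (t ^+ (Knat x + Snat x))%:E =
   \int[P]_x (t ^+ Knat x)%:E * \int[P]_x (t ^+ Snat x)%:E)%E.
Proof.
move=> t0; pose F (b : bool) := sigma_rv (if b then (K : T -> R) else S).
have mF b A : F b A -> measurable A by case: b; exact: sigma_rv_measurable.
have FK k : F true (Knat @^-1` [set k]).
  by rewrite (fiber_natr k KnatE); exact: sigma_rv_preimage.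
have FS k : F false (Snat @^-1` [set k]).
  by rewrite (fiber_natr k SnatE); exact: sigma_rv_preimage.
have tm0 k : 0 <= t ^+ k by rewrite exprn_ge0.
have [_ indK] := indep_funM mF (indep_fun1 mF K_indep) (I : setT true) FK tm0.
have SK : ([set: bool] `\ true) false by split.
have [+ _] := indep_funM mF indK SK FS tm0.
under eq_integral do rewrite mul1r -exprD.
by under [X in _ = (X * _)%E -> _]eq_integral do rewrite mul1r.
Qed.

Let weighted_pgf (t : R) : 0 <= t <= 1 ->
  (\int[P]_x (X v x * t ^+ Snat x)%:E =
   \int[P]_x (lambda v * fine (mean (B v)) * t ^+ (Knat x + Snat x))%:E)%E.
Proof.
move=> t01; have /andP[t0 t1] := t01.
have [GE bstarE bprimeE Kindep _] := KE.
have [m mE m0] := mean_fineK (B_mean v).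
have tm0 k : 0 <= t ^+ k by rewrite exprn_ge0.
have mB u : measurable_fibers (B u) by exact: measurable_fibers_rv.
have /choice[phi phiP] : forall u, exists p : R,
    (\int[P]_x (t ^+ B u x)%:E = p%:E)%E /\ 0 <= p <= 1.
  by move=> u; have [p pE p01] := pgf_itv P (mB u) t01; exists p.
have phi01 u : 0 <= phi u <= 1 by case: (phiP u).
have phi0 u : 0 <= phi u by case/andP: (phi01 u).
have mBstar i : measurable_fibers (Bstar i) by exact: measurable_fibers_rv.
have [chi chiE chi01] := pgf_itv P (mBstar 0%N) t01.
have chi0 : 0 <= chi by case/andP: chi01.
have psiE i : (\int[P]_x ((B v x)%:R * t ^+ B v x)%:E = mean (B v) * \int[P]_x (t
  ^+ Bstar i x)%:E)%E.
  by apply: size_biased_pgf.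
(* All [Bstar i] have the same transform, since its product with the nonzero mean is E[B t^B], which
   does not involve i. *)
have chiE' i : (\int[P]_x (t ^+ Bstar i x)%:E = chi%:E)%E.
  have [p pE _] := pgf_itv P (mBstar i) t01; rewrite pE.
  have := psiE i; rewrite (psiE 0%N) pE chiE mE -!EFinM => -[] /mulfI -> //.
  by rewrite gt_eqF.
pose eta1 := eta e v v [eta phi with v |-> 1] (thinning_prob e lambda alpha v).
have claim_pgf u j : (\int[P]_x (t ^+ claim (u, j) x)%:E = (phi u)%:E)%E.
  rewrite (copy_integral (h := fun k => t ^+ k) (Bs_copy u j))//.
  by case: (phiP u).
have S_pgf : (\int[P]_x (t ^+ Snat x)%:E = \int[P]_x (\prod_u phi u ^+ N u x)%:E)%E.
  apply: (compound_pgf (c0 := inl tt) (c := inr) (D := setT) (Z := claim)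
    Fclaim_measurable Bs_indep) => //.
  - exact: g_sigma_preimage_vector.
  - by move=> ? ? [].
  - by move=> [u j] k; exact: sigma_rv_preimage.
have S_bias : (\int[P]_x (X v x * t ^+ Snat x)%:E = (m * chi)%:E *
    \int[P]_x ((N v x)%:R * phi v ^+ (N v x).-1 * \prod_(u | u != v) phi u ^+ N u
      x)%:E)%E.
  have XvE x : X v x = (\sum_(j < N v x) claim (v, (j : nat)) x)%:R.
    by rewrite XE /compound natr_sum.
  under eq_integral do rewrite XvE.
  apply: (compound_size_bias (c0 := inl tt) (c := inr) (D := setT) (Z := claim)
    Fclaim_measurable Bs_indep) => //.
  - exact: g_sigma_preimage_vector.
  - by move=> ? ? [].
  - by move=> [u j] k; exact: sigma_rv_preimage.
  - by rewrite mulr_ge0// ltW.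
  - move=> j; rewrite (copy_integral (h := fun k => k%:R * t ^+ k) (Bs_copy v j)).
      by rewrite (psiE 0%N) mE chiE.
    by move=> k; rewrite mulr_ge0.
  - by under eq_fun do rewrite -XvE; exact: measurable_funP.
have K_pgf : (\int[P]_x (t ^+ Knat x)%:E = (chi * eta1)%:E)%E.
  (* The terms of K have transform [chi] at [v] and [phi u] elsewhere, so [eta] is taken at this
     point; linearity at the root extracts [chi]. *)
  have upd01 u : 0 <= [eta phi with v |-> chi] u <= 1 by rewrite /=; case: ifP.
  rewrite -eta_root_linear// -GE; last first.
    by move=> u; have /andP[p0 ->] := upd01 u; rewrite (le_trans _ p0) ?lerN10.
  rewrite unlock.
  apply: (compound_pgf (c0 := inl (inl tt)) (c := term_index) (Z := kterm)
    Fterm_measurable Kindep) => //.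
  - exact: g_sigma_preimage_vector.
  - by move=> [u j]; rewrite /term_index /=; case: ifP.
  - by move=> [u j]; rewrite /term_index /=; case: eqP => //= /eqP.
  - by move=> u /=; case: ifP.
  - move=> u j; rewrite /kterm /=; case: eqP => [_|/eqP uv]; first exact: chiE'.
    rewrite (copy_integral (h := fun k => t ^+ k) (bprimeE u j uv))//.
    by case: (phiP u).
rewrite S_bias (MPMRF_size_bias tree_e adm N_MPMRF v phi01) -S_pgf mE /=.
under [RHS]eq_integral do rewrite EFinM.
have mKS : measurable_fun setT (fun x => t ^+ (Knat x + Snat x)).
  exact: (measurable_fun_fibers (fun k => t ^+ k) (measurable_fibersD mKnat mSnat)).
rewrite [RHS]ge0_integralZl_EFin//; first last.
- by have [l0 _ _] := adm; rewrite mulr_ge0 ?ltW.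
- exact/measurable_EFinP.
- by move=> x _; rewrite lee_fin.
rewrite KSnat_pgf// K_pgf !muleA -!EFinM; congr (_%:E * _)%E.
by rewrite -/eta1; ring.
Qed.

(** Both S and K + S take natural values, so the identity of masses at points, obtained from
    [weighted_pgf], is summed over the naturals in [A]. *)
Lemma integral_contribution (KS : {RV P >-> R}) (KSE : forall w, KS w = K w + S w)
    (A : set R) : measurable A ->
  (\int[P]_x (X v x * \1_(S @^-1` A) x)%:E =
   (lambda v)%:E * mean (B v) * P (KS @^-1` A))%E.
Proof.
move=> mA; have [m mE m0] := mean_fineK (B_mean v).
have [l0 _ _] := adm.
pose KSnat x := (Knat x + Snat x)%N.
have KSnatE x : KS x = (KSnat x)%:R by rewrite KSE KnatE SnatE natrD.
have mKSnat : measurable_fibers KSnat by exact: measurable_fibersD.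
have X0 x : 0 <= X v x by rewrite XE /compound sumr_ge0.
have mX : measurable_fun setT (X v) by exact: measurable_funP.
have c0 : 0 <= lambda v * m by rewrite mulr_ge0 ?ltW.
have law k : (\int[P]_(x in Snat @^-1` [set k]) (X v x)%:E =
              \int[P]_(x in KSnat @^-1` [set k]) (cst (lambda v * m) x)%:E)%E.
  apply: pgf_integral_inj => //.
    (* At t = 1 the equality of transforms says that X_v has mean lambda_v E[B_v], which gives the
       finiteness required by [pgf_integral_inj]. *)
    have := weighted_pgf (t := 1); rewrite ler01 lexx mE => /(_ isT).
    under eq_integral do rewrite expr1n mulr1.
    under [X in _ = X -> _]eq_integral do rewrite expr1n mulr1.
    move=> ->; rewrite -[X in (X < _)%E]/(\int[P]_x cst (lambda v * m)%:E x)%E.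
    by rewrite integral_cst// -ge0_fin_numE ?mule_ge0// fin_numM// fin_num_measure.
  move=> t /andP[t0 t1]; have t01 : 0 <= t <= 1 by rewrite t1 ltW.
  by rewrite weighted_pgf// mE.
rewrite -integral_setI_indic setTI mE.
have mpre (Y : {RV P >-> R}) : measurable (Y @^-1` A).
  by rewrite -[X in measurable X]setTI; exact: measurable_funP.
transitivity (\int[P]_(x in KS @^-1` A) (cst (lambda v * m) x)%:E)%E; last first.
  rewrite -[LHS]/(\int[P]_(x in KS @^-1` A) cst (lambda v * m)%:E x)%E.
  by rewrite integral_cst// EFinM.
rewrite [LHS](ge0_integral_fibers mSnat)//; last exact/measurable_EFinP.
rewrite [RHS](ge0_integral_fibers mKSnat)//; last first.
  by apply/measurable_EFinP; exact: measurable_cst.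
apply: eq_eseriesr => k _.
have [Ak|nAk] := pselect (A k%:R).
  have -> : S @^-1` A `&` Snat @^-1` [set k] = Snat @^-1` [set k].
    by apply/seteqP; split=> x /= => [[]//|xk]; rewrite SnatE xk.
  have -> : KS @^-1` A `&` KSnat @^-1` [set k] = KSnat @^-1` [set k].
    by apply/seteqP; split=> x /= => [[]//|xk]; rewrite KSnatE xk.
  exact: law.
have -> : S @^-1` A `&` Snat @^-1` [set k] = set0.
  by apply/seteqP; split=> x //= [+ xk]; rewrite SnatE xk.
have -> : KS @^-1` A `&` KSnat @^-1` [set k] = set0.
  by apply/seteqP; split=> x //= [+ xk]; rewrite KSnatE xk.
by rewrite !integral_set0.
Qed.

End EulerContribution.

Theorem corollary4p4 (R : realType) (n : nat) (e : rel 'I_n)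
    (lambda : 'I_n -> R) (alpha : 'I_n -> 'I_n -> R)
    (tree_e : is_tree e) (adm : admissible e lambda alpha)
    (d : measure_display) (T : measurableType d) (P : probability T R)
    (N : 'I_n -> {RV P >-> nat}) (N_MPMRF : MPMRF e lambda alpha N)
    (B : 'I_n -> {RV P >-> nat}) (Bs : 'I_n -> nat -> {RV P >-> nat})
    (B_mean : forall v, (0 < mean (B v) < +oo)%E)
    (Bs_copy : forall v j, copy (Bs v j) (B v))
    (Bs_indep : claims_independent N Bs)
    (X : 'I_n -> {RV P >-> R}) (S : {RV P >-> R})
    (XE : forall v w, X v w = compound (N v) (Bs v) w)
    (SE : forall w, S w = \sum_v X v w)
    (v : 'I_n) (kappa : R) (kappa01 : 0 <= kappa < 1)
    (G : 'I_n -> {RV P >-> nat}) (Bstar : nat -> {RV P >-> nat})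
    (Bprime : 'I_n -> nat -> {RV P >-> nat}) (K : {RV P >-> R})
    (KE : K_construction e lambda alpha B v G Bstar Bprime K)
    (K_indep : independent_rv P K S)
    (KS : {RV P >-> R}) (KSE : forall w, KS w = K w + S w) :
  let q := VaR S kappa in
  TVaR_contribution (X v) S kappa =
  ((lambda v)%:E * mean (B v) * ((1 - kappa)^-1)%:E *
   (1 - cdf KS q
    + (cdf S q - kappa%:E) * ((pmf S q)^-1)%:E * (pmf KS q)%:E))%E.
Proof.
move=> q; rewrite /TVaR_contribution /cond_expectation -/q.
have key := integral_contribution tree_e adm N_MPMRF B_mean Bs_copy Bs_indep XE SE
  KE K_indep KSE.
(* Both expectations in Euler's rule are instances of [key], for the half-line above [q] and for the
   point [q]. *)
have -> : [set w | q < S w] = S @^-1` `]q, +oo[.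
  by apply/seteqP; split=> w /=; rewrite in_itv/= andbT.
have -> : ('E_P[X v \* \1_(S @^-1` `]q, +oo[)] = (lambda v)%:E * mean (B v) * (1 -
  cdf KS q))%E.
  by rewrite unlock key// -ccdf_1_cdf.
have -> : ('E_P[X v \* \1_(S @^-1` [set q])] = (lambda v)%:E * mean (B v) * (pmf KS
  q)%:E)%E.
  rewrite unlock key// /pmf fineK//; apply: fin_num_measure.
  by rewrite -[X in measurable X]setTI; exact: measurable_funP.
have [m -> _] := mean_fineK (B_mean v).
have cdfE (Y : {RV P >-> R}) : cdf Y q = (fine (cdf Y q))%:E.
  by rewrite fineK// fin_num_measure.
(* All quantities are now finite, and the inverse of [pmf S q] is the same factor on both sides, so
   a ring identity in [R] remains. *)
rewrite (cdfE KS) (cdfE S) -!EFinB -!EFinM; congr _%:E.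
move: (fine _) (fine _) (pmf KS q) (_^-1) (_^-1) => a b c x y; ring.
Qed.
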